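(* Let $r$ be an analytic tensor field of type $(0,2)$ around $0\in\mathbb{R}^n$. The family of real analytic linear connections $\nabla$ with Ricci tensor $\mathrm{Ric}=r$ depends bijectively on $n^3-n^2$ analytic functions of $n$ variables and $n^2$ analytic functions of $n-1$ variables.
   Context: Connections, tensor fields and functions in a neighborhood of $0$ are understood as their germs at $0$. The linear connections are allowed to have arbitrary torsion. In an analytic coordinate system $(x^1,\dots,x^n)$, with Christoffel symbols given by $\nabla_{\partial_i}\partial_j=\sum_k\Gamma^k_{ij}\partial_k$, the Ricci tensor of $\nabla$ is $$\mathrm{Ric}(\partial_i,\partial_j)=\sum_{k=1}^n\Big[\tfrac{\partial\Gamma^k_{ij}}{\partial x^k}-\tfrac{\partial\Gamma^k_{kj}}{\partial x^i}\Big]+\sum_{k,l=1}^n\big[\Gamma^l_{ij}\Gamma^k_{kl}-\Gamma^l_{kj}\Gamma^k_{il}\big].$$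
   Formalization: The formal statement assumes n ≥ 2; for n = 1 the Ricci tensor vanishes identically, so for r ≠ 0 no connection has Ric = r and for r = 0 every connection does, and the claimed dependence on a single constant fails. *)

(* Defs.v *)
From mathcomp Require Import all_boot all_order all_algebra.
From mathcomp Require Import all_classical all_reals all_analysis.
From mathcomp Require summability.

Set Implicit Arguments.
Unset Strict Implicit.
Unset Printing Implicit Defensive.
Import Order.TTheory GRing.Theory Num.Theory.
Import numFieldNormedType.Exports.
Local Open Scope classical_set_scope.
Local Open Scope ring_scope.

(* Germs at 0 are handled through representatives: total functions, compared
   by equality on some neighborhood of 0. *)
Definition eq_germ {R : realType} {n : nat} {T : Type}
    (f g : 'rV[R]_n -> T) : Prop :=
  \forall x \near (0 : 'rV[R]_n), f x = g x.

Definition monomial {R : realType} {n : nat}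
    (a : {ffun 'I_n -> nat}) (x : 'rV[R]_n) : R :=
  \prod_(i < n) x 0 i ^+ a i.

(* [totally] is the filter of the finite sets of multi-indices ordered by
   inclusion: the power series converges unconditionally, i.e. absolutely. *)
Definition analytic {R : realType} {n : nat} (f : 'rV[R]_n -> R) : Prop :=
  exists c : {ffun 'I_n -> nat} -> R, \forall x \near (0 : 'rV[R]_n),
    summability.partial_sum (fun a => c a * monomial a x)
      @ summability.totally --> f x.

Definition vfield (R : realType) (n : nat) : Type := 'rV[R]_n -> 'rV[R]_n.

Definition analytic_vfield {R : realType} {n : nat} (X : vfield R n) : Prop :=
  forall i : 'I_n, analytic (fun x => X x 0 i).

(* Tensor fields of type (0,2), given by their matrix in the basis d/dx^i. *)
Definition tensor02 (R : realType) (n : nat) : Type := 'rV[R]_n -> 'M[R]_n.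

Definition analytic_tensor02 {R : realType} {n : nat} (r : tensor02 R n) :
    Prop :=
  forall i j : 'I_n, analytic (fun x => r x i j).

Definition connop (R : realType) (n : nat) : Type :=
  vfield R n -> vfield R n -> vfield R n.

(* Germs at 0 of real analytic linear connections, with no condition on the
   torsion: only the values on analytic vector fields matter, see
   [eq_connection]. *)
Record is_connection {R : realType} {n : nat} (nabla : connop R n) : Prop := {
  conn_analytic : forall X Y, analytic_vfield X -> analytic_vfield Y ->
    analytic_vfield (nabla X Y);
  conn_germ : forall X X' Y Y',
    analytic_vfield X -> analytic_vfield X' ->
    analytic_vfield Y -> analytic_vfield Y' ->
    eq_germ X X' -> eq_germ Y Y' -> eq_germ (nabla X Y) (nabla X' Y');
  conn_addl : forall X X' Y,
    analytic_vfield X -> analytic_vfield X' -> analytic_vfield Y ->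
    eq_germ (nabla (fun x => X x + X' x) Y)
            (fun x => nabla X Y x + nabla X' Y x);
  conn_scalel : forall f X Y,
    analytic f -> analytic_vfield X -> analytic_vfield Y ->
    eq_germ (nabla (fun x => f x *: X x) Y) (fun x => f x *: nabla X Y x);
  conn_addr : forall X Y Y',
    analytic_vfield X -> analytic_vfield Y -> analytic_vfield Y' ->
    eq_germ (nabla X (fun x => Y x + Y' x))
            (fun x => nabla X Y x + nabla X Y' x);
  conn_leibniz : forall f X Y,
    analytic f -> analytic_vfield X -> analytic_vfield Y ->
    eq_germ (nabla X (fun x => f x *: Y x))
            (fun x => 'D_(X x) f x *: Y x + f x *: nabla X Y x)
}.

Definition eq_connection {R : realType} {n : nat} (nabla nabla' : connop R n) :
    Prop :=
  forall X Y, analytic_vfield X -> analytic_vfield Y ->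
    eq_germ (nabla X Y) (nabla' X Y).

Definition basis_vec {R : realType} {n : nat} (i : 'I_n) : 'rV[R]_n :=
  delta_mx 0 i.

Definition coord_field {R : realType} {n : nat} (i : 'I_n) : vfield R n :=
  fun=> basis_vec i.

(* [christoffel nabla k i j] is Gamma^k_{ij}. *)
Definition christoffel {R : realType} {n : nat} (nabla : connop R n)
    (k i j : 'I_n) : 'rV[R]_n -> R :=
  fun x => nabla (coord_field i) (coord_field j) x 0 k.

Definition ricci {R : realType} {n : nat} (nabla : connop R n) :
    tensor02 R n :=
  fun x => let G := christoffel nabla in
  \matrix_(i < n, j < n)
    (\sum_(k < n) ('D_(basis_vec k) (G k i j) x
                   - 'D_(basis_vec i) (G k k j) x)
     + \sum_(k < n) \sum_(l < n)
         (G l i j x * G k k l x - G l k j x * G k i l x)).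

Definition ricci_family {R : realType} {n : nat} (r : tensor02 R n) :
    set (connop R n) :=
  [set nabla | is_connection nabla /\ eq_germ (ricci nabla) r].

(* [f] induces a bijection from the quotient A/eS onto the quotient B/eT. *)
Definition quotient_bij {S T : Type} (eS : S -> S -> Prop) (eT : T -> T -> Prop)
    (A : set S) (B : set T) (f : S -> T) : Prop :=
  [/\ forall s, A s -> B (f s),
      forall s s', A s -> A s' -> (eS s s' <-> eT (f s) (f s'))
    & forall t, B t -> exists2 s, A s & eT (f s) t].

(* The parametrization of the hyperplane x^m = 0 by the n-1 other coordinates. *)
Definition hyperplane {R : realType} {n : nat} (m : 'I_n) (y : 'rV[R]_n.-1) :
    'rV[R]_n :=
  \row_i (if unlift m i is Some j then y 0 j else 0).

(* p functions of n variables and q functions of n-1 variables. *)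
Definition data (R : realType) (n p q : nat) : Type :=
  (('I_p -> 'rV[R]_n -> R) * ('I_q -> 'rV[R]_n.-1 -> R))%type.

Definition analytic_data {R : realType} {n p q : nat} : set (data R n p q) :=
  [set d | (forall a, analytic (d.1 a)) /\ (forall b, analytic (d.2 b))].

Definition eq_data {R : realType} {n p q : nat} (d d' : data R n p q) : Prop :=
  (forall a, eq_germ (d.1 a) (d'.1 a)) /\ (forall b, eq_germ (d.2 b) (d'.2 b)).

(* An abstract bijection would only compare cardinalities (all these sets of
   germs have that of the continuum). The meaning intended is that of the
   Cauchy-Kowalevski theorem: the n^3 Christoffel symbols split into p symbols,
   which are prescribed as germs of functions of n variables, and q symbols,
   whose restrictions to a coordinate hyperplane are prescribed; each choice of
   these data determines exactly one connection of the family. *)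
Definition depends_bijectively {R : realType} {n : nat}
    (F : set (connop R n)) (p q : nat) : Prop :=
  exists (m : 'I_n) (free : 'I_p -> 'I_n * 'I_n * 'I_n)
         (init : 'I_q -> 'I_n * 'I_n * 'I_n),
    bijective (fun u : 'I_p + 'I_q =>
                 match u with inl a => free a | inr b => init b end) /\
    quotient_bij eq_connection eq_data F analytic_data
      (fun nabla : connop R n =>
         let G (s : 'I_n * 'I_n * 'I_n) :=
           christoffel nabla s.1.1 s.1.2 s.2 in
         (fun a => G (free a), fun b => G (init b) \o hyperplane m)).

(* Main.v *)
(* The (i, j) component of Ric = r can be solved for the derivative in x^m of
   one symbol: Gamma^m_{ij} if i <> m, and Gamma^{k0}_{k0 j} if i = m, where
   k0 <> m is fixed. These n^2 principal symbols then obey a system in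
   Cauchy-Kovalevskaya form, whose other terms are derivatives of principal
   symbols tangent to x^m = 0, arbitrary derivatives of the n^3 - n^2 remaining
   symbols, and quadratic terms. Comparing coefficients determines the series
   of the principal symbols recursively in the order in x^m, from the remaining
   symbols and the values on x^m = 0. The series converge because of the bound
   K^(|a|+1) |a|!/a! theta^(a_m) on the coefficients of x^a, that is, by the
   majorant K / (1 - K (theta x^m + sum_(k <> m) x^k)): the recursion preserves
   this bound as soon as theta exceeds the number of terms of an equation. *)

(* The choice of principal symbols is dictated by a cancellation. For i = m the terms with k = m in
   the linear part of Ric, the x^m-derivatives of Gamma^m_{mj}, cancel, so these symbols cannot be
   solved for; a second index k0 takes over, and n > 1 provides it. Each equation then contains the
   x^m-derivative of its own principal symbol once, with coefficient 1 or -1, and of no other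
   principal symbol. A plain geometric bound K^|a| would not survive the recursion: a derivative in
   x^k multiplies a coefficient by a_k + 1, whereas solving for the x^m-derivative divides by a_m +
   1 only, which is small when the order in x^m is small. The multinomial weight |a|!/a! makes all
   directions cost the same. The factor theta is granted to principal symbols only: the remaining
   ones may be differentiated in x^m, and a power of theta in their bound would grow under that
   derivative. *)
Require Import Defs.
From mathcomp Require Import all_boot all_order all_algebra finmap.
From mathcomp Require Import all_classical all_reals all_analysis.
From mathcomp Require Import ring lra.
From mathcomp Require summability.

Set Implicit Arguments.
Unset Strict Implicit.
Unset Printing Implicit Defensive.
Import Order.TTheory GRing.Theory Num.Theory.
Import numFieldNormedType.Exports.
Local Open Scope classical_set_scope.
Local Open Scope ring_scope.

#[local] Existing Instance summability.totally_filter.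

Definition has_sum {R : realType} {I : choiceType} (g : I -> R) (l : R) : Prop :=
  summability.partial_sum g @ summability.totally --> l.

(** * Unconditional summation *)

Section HasSum.
Variable R : realType.
Implicit Types I J : choiceType.

Lemma eq_ler (x y : R) : x = y -> x <= y.
Proof. by move=> ->. Qed.

Lemma partial_sumE I (g : I -> R) (A : {fset I}) :
  summability.partial_sum g A = \sum_(i <- A) g i.
Proof. by rewrite /summability.partial_sum big_seq_fsetE. Qed.

Lemma has_sumP I (g : I -> R) (l : R) : has_sum g l <->
  forall e : R, 0 < e -> exists A : {fset I}, forall B : {fset I},
    (A `<=` B)%fset -> `|l - \sum_(i <- B) g i| < e.
Proof.
split=> [/cvgrPdist_lt gl e e0|gl].
  have [A _ AB] := gl e e0; exists A => B /AB /=.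
  by rewrite partial_sumE.
apply/cvgrPdist_lt => e e0; have [A AB] := gl e e0.
by exists A => // B /= /AB; rewrite partial_sumE.
Qed.

Lemma has_sum_unique I (g : I -> R) l l' : has_sum g l -> has_sum g l' -> l = l'.
Proof. exact: cvg_unique. Qed.

Lemma has_sumD I (g h : I -> R) l l' : has_sum g l -> has_sum h l' ->
  has_sum (fun i => g i + h i) (l + l').
Proof.
move=> gl hl; rewrite /has_sum.
rewrite (_ : summability.partial_sum _ =
  (fun A => summability.partial_sum g A + summability.partial_sum h A)).
  exact: cvgD.
by apply/funext => A; rewrite /summability.partial_sum big_split.
Qed.

Lemma has_sumZ I (g : I -> R) l k : has_sum g l -> has_sum (fun i => k * g i) (k * l).
Proof.
move=> gl; rewrite /has_sum.
rewrite (_ : summability.partial_sum _ =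
  (fun A => k * summability.partial_sum g A)).
  by apply: cvgM => //; exact: cvg_cst.
by apply/funext => A; rewrite /summability.partial_sum mulr_sumr.
Qed.

Lemma has_sumN I (g : I -> R) l : has_sum g l -> has_sum (fun i => - g i) (- l).
Proof.
move=> /(@has_sumZ _ _ _ (-1)); rewrite mulN1r; congr has_sum.
by apply/funext => i; rewrite mulN1r.
Qed.

Lemma has_sum0 I : has_sum (fun _ : I => 0 : R) 0.
Proof.
apply/has_sumP => e e0; exists fset0 => B _.
by rewrite big1// subrr normr0.
Qed.

Lemma has_sum_sum I (T : Type) (s : seq T) (g : T -> I -> R) (l : T -> R) :
  (forall t, has_sum (g t) (l t)) ->
  has_sum (fun i => \sum_(t <- s) g t i) (\sum_(t <- s) l t).
Proof.
move=> gl; elim: s => [|t s IH].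
  rewrite big_nil; under eq_fun do rewrite big_nil.
  exact: has_sum0.
rewrite big_cons; under eq_fun do rewrite big_cons.
exact: has_sumD.
Qed.

Lemma has_sum_le I (g : I -> R) l M : has_sum g l ->
  (forall A : {fset I}, `|\sum_(i <- A) g i| <= M) -> `|l| <= M.
Proof.
move=> /has_sumP gl gM; apply/ler_addgt0Pr => e e0.
have [A /(_ A (fsubset_refl _)) AB] := gl e e0.
rewrite -(subrK (\sum_(i <- A) g i) l) addrC (le_trans (ler_normD _ _))//.
by rewrite lerD// ltW.
Qed.

Lemma fset_sum_subset I (g : I -> R) (A B : {fset I}) : (forall i, 0 <= g i) ->
  (A `<=` B)%fset -> \sum_(i <- A) g i <= \sum_(i <- B) g i.
Proof.
move=> g0 AB; rewrite (big_fsetID _ (mem A) B) /=.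
rewrite [X in _ <= X + _](_ : _ = \sum_(i <- A) g i).
  by rewrite lerDl sumr_ge0.
by apply: perm_big; apply: uniq_perm => // i; rewrite !inE /=;
  case iA: (i \in A); rewrite ?andbF// ?andbT; rewrite (fsubsetP AB).
Qed.

Lemma has_sum_exists_ge0 I (g : I -> R) M : (forall i, 0 <= g i) ->
  (forall A : {fset I}, \sum_(i <- A) g i <= M) -> exists l, has_sum g l.
Proof.
move=> g0 gM; pose S := [set \sum_(i <- A) g i | A in [set: {fset I}]].
have supS : has_sup S.
  split; first by exists (\sum_(i <- fset0) g i); exists fset0.
  by exists M => _ [A _ <-].
exists (sup S); apply/has_sumP => e e0.
have [_ [A _ <-] Ae] := sup_adherent e0 supS.
exists A => B AB; rewrite ger0_norm.
  by rewrite ltrBlDl -ltrBlDr (lt_le_trans Ae)// fset_sum_subset.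
by rewrite subr_ge0 ub_le_sup//; [case: supS|exists B].
Qed.

(** Write [g] as the difference of [|g| + g] and [|g|], two nonnegative families with bounded finite
    sums. *)
Lemma has_sum_exists I (g : I -> R) M :
  (forall A : {fset I}, \sum_(i <- A) `|g i| <= M) -> exists l, has_sum g l.
Proof.
move=> gM.
have [l1 h1] : exists l, has_sum (fun i => `|g i|) l.
  exact: (has_sum_exists_ge0 (M := M)).
have [l2 h2] : exists l, has_sum (fun i => `|g i| + g i) l.
  apply: (@has_sum_exists_ge0 _ _ (M + M)) => [i|A].
    by rewrite -lerBlDr sub0r -normrN ler_norm.
  rewrite big_split lerD// (le_trans _ (gM A))// ler_sum// => i _.
  exact: ler_norm.
exists (l2 - l1); have := has_sumD h2 (has_sumN h1); congr has_sum.
by apply/funext => i; rewrite addrAC subrr add0r.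
Qed.

(** Regrouping along a map with finite, possibly empty, fibers: a finite set containing the image of
    [A] has a finite preimage containing [A]. Cauchy products, the index shift of a derivative and
    the restriction to a hyperplane are all instances. *)
Lemma has_sum_fiber I J (p : I -> J) (fib : J -> seq I) (g : I -> R) l :
  (forall j, uniq (fib j)) -> (forall i j, (i \in fib j) = (p i == j)) ->
  has_sum g l -> has_sum (fun j => \sum_(i <- fib j) g i) l.
Proof.
move=> ufib memf /has_sumP gl; apply/has_sumP => e e0.
have [A AB] := gl e e0.
exists [fset p i | i in A]%fset => B pAB.
pose B' := [fset i in flatten [seq fib j | j <- B]]%fset.
have memB' i : (i \in B') = (p i \in B).
  rewrite inE; apply/flattenP/idP => /=.
    by move=> [s /mapP[j jB ->]]; rewrite memf => /eqP ->.
  by move=> piB; exists (fib (p i)); [exact: map_f|rewrite memf].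
have -> : \sum_(j <- B) \sum_(i <- fib j) g i = \sum_(i <- B') g i.
  rewrite -big_allpairs_dep /=.
  apply: perm_big; apply: uniq_perm => //.
    apply: allpairs_uniq_dep => // -[j i] [j' i'].
    move=> /allpairsPdep[j1 [i1 [_ + E]]] /allpairsPdep[j2 [i2 [_ + E']]] /= i12.
    have Ej := congr1 tag E; have Ei := congr1 (fun q : {_ : J & I} => tagged q) E.
    have Ej' := congr1 tag E'.
    have Ei' := congr1 (fun q : {_ : J & I} => tagged q) E'.
    rewrite /= in Ej Ei Ej' Ei' i12; subst j i j' i'.
    by rewrite !memf i12 => /eqP <- /eqP <-.
  move=> i; rewrite memB'; apply/allpairsPdep/idP.
    by move=> [j [i' [jB + ->]]]; rewrite memf => /eqP ->.
  by move=> piB; exists (p i), i; rewrite memf.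
apply: AB; apply/fsubsetP => i iA; rewrite memB'.
by apply: (fsubsetP pAB); apply/imfsetP; exists i.
Qed.

Lemma fset_sum_fsetM I J (g : I -> R) (h : J -> R) (A : {fset I}) (B : {fset J}) :
  \sum_(p <- (A `*` B)%fset) g p.1 * h p.2 =
  (\sum_(i <- A) g i) * (\sum_(j <- B) h j).
Proof.
rewrite mulr_suml; under [RHS]eq_bigr do rewrite mulr_sumr.
rewrite -(big_allpairs (F := fun p => g p.1 * h p.2)) /=.
apply: perm_big; apply: uniq_perm => //.
  exact: fset_uniq.
  by apply: (allpairs_uniq (f := pair)); rewrite ?fset_uniq// => -[? ?] [? ?] _ _ [-> ->].
move=> [i j]; rewrite in_fsetM /=; apply/andP/allpairsP => /=.
  by move=> [iA jB]; exists (i, j).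
by move=> [[i' j'] [/= ? ? [-> ->]]].
Qed.

(** The absolute bounds give the double family some sum; its value is read along the rectangles,
    which are cofinal because a finite set of pairs lies in the product of its projections. *)
Lemma has_sumM I J (g : I -> R) (h : J -> R) l l' M M' :
  (forall A : {fset I}, \sum_(i <- A) `|g i| <= M) ->
  (forall A : {fset J}, \sum_(i <- A) `|h i| <= M') ->
  has_sum g l -> has_sum h l' -> has_sum (fun p => g p.1 * h p.2) (l * l').
Proof.
move=> gM hM gl hl.
have subM (C : {fset I * J}) :
    (C `<=` [fset p.1 | p in C] `*` [fset p.2 | p in C])%fset.
  apply/fsubsetP => p pC; rewrite in_fsetM.
  by apply/andP; split; apply/imfsetP; exists p.
have [l2 h2] : exists l2, has_sum (fun p => g p.1 * h p.2) l2.
  apply: (@has_sum_exists _ _ (M * M')) => C.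
  apply: (le_trans (fset_sum_subset (fun _ => normr_ge0 _) (subM C))).
  under eq_bigr do rewrite normrM.
  rewrite (fset_sum_fsetM (fun i => `|g i|) (fun j => `|h j|)).
  by apply: ler_pM => //; exact: sumr_ge0.
suff -> : l * l' = l2 by [].
have := cvgM (cvg_comp _ _ (@cvg_fst _ _ summability.totally summability.totally _) gl)
  (cvg_comp _ _ (@cvg_snd _ _ summability.totally summability.totally _) hl).
move=> /(_ _ _ _) /cvg_unique; apply => //.
rewrite (_ : _ \* _ = summability.partial_sum (fun p => g p.1 * h p.2) \o
   (fun AB => AB.1 `*` AB.2)%fset); last first.
  apply/funext => -[A B] /=; rewrite !partial_sumE.
  by rewrite -[LHS]fset_sum_fsetM.
apply: cvg_comp h2 => P [C _ CP].
exists ([set A | [fset p.1 | p in C] `<=` A]%fset,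
        [set B | [fset p.2 | p in C] `<=` B]%fset) => /=.
  by split; [exists [fset p.1 | p in C]%fset|exists [fset p.2 | p in C]%fset].
move=> [A B] [/= CA CB]; apply: CP => /=.
apply: fsubset_trans (subM C) _; apply/fsubsetP => -[i j].
by rewrite !in_fsetM /= => /andP[/(fsubsetP CA) -> /(fsubsetP CB) ->].
Qed.

Lemma has_sum_bounded I (g : I -> R) l : has_sum g l ->
  exists M, forall i, `|g i| <= M.
Proof.
move=> /has_sumP /(_ 1 ltr01) [A AB].
(* Outside [A], a term is the difference of two partial sums that are both within 1 of [l], which
   accounts for the 2. *)
exists (2 + \sum_(i <- A) `|g i|) => i.
have [iA|iA] := boolP (i \in A).
  rewrite (big_fsetD1 i) //= addrCA lerDl addr_ge0// sumr_ge0//.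
have h1 := AB A (fsubset_refl _).
have h2 := AB (i |` A)%fset (fsubsetU1 _ _).
rewrite (big_fsetU1 _ _ iA) /= in h2.
apply: (@le_trans _ _ 2); last by rewrite lerDl sumr_ge0.
by move: h1 h2; rewrite !ltr_norml ler_norml => /andP[? ?] /andP[? ?]; lra.
Qed.

Lemma has_sum1 I (i0 : I) (k : R) : has_sum (fun i => if i == i0 then k else 0) k.
Proof.
apply/has_sumP => e e0; exists [fset i0]%fset => B; rewrite fsub1set => i0B.
rewrite (big_fsetD1 i0)//= eqxx big_seq big1 ?addr0 ?subrr ?normr0// => i.
by rewrite in_fsetD1 => /andP[/negbTE ->].
Qed.

End HasSum.

(** * Multi-indices *)

Section MultiIndex.
Variable n : nat.
Implicit Types a b : {ffun 'I_n -> nat}.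

Definition mdeg a : nat := (\sum_(i < n) a i)%N.

Definition munit (i : 'I_n) : {ffun 'I_n -> nat} := [ffun j => (j == i : nat)].

(** The subtraction is truncated: [a] is returned unchanged if [a i = 0]. Uses are either guarded by
    [0 < a i] or multiplied by [a i]. *)
Definition mpred (i : 'I_n) a : {ffun 'I_n -> nat} := [ffun j => (a j - (j == i))%N].

Lemma mDE a b i : (a + b) i = (a i + b i)%N.
Proof. by rewrite ffunE. Qed.

Lemma mdegD a b : mdeg (a + b) = (mdeg a + mdeg b)%N.
Proof. by rewrite /mdeg -big_split; apply: eq_bigr => i _; rewrite mDE. Qed.

Lemma mdeg_unit i : mdeg (munit i) = 1%N.
Proof.
rewrite /mdeg (bigD1 i) //= ffunE eqxx big1 // => j /negbTE ji.
by rewrite ffunE ji.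
Qed.

Lemma mdegS a i : mdeg (a + munit i) = (mdeg a).+1.
Proof. by rewrite mdegD mdeg_unit addn1. Qed.

Lemma mSE a i j : (a + munit i) j = (a j + (j == i))%N.
Proof. by rewrite mDE ffunE. Qed.

Lemma mpredK a i : (0 < a i)%N -> mpred i a + munit i = a.
Proof.
move=> ai; apply/ffunP => j; rewrite mSE ffunE.
by case: eqP => [->|_]; rewrite ?subn0 ?addn0 // subnK.
Qed.

Lemma mSK a i : mpred i (a + munit i) = a.
Proof. by apply/ffunP => j; rewrite ffunE mSE addnK. Qed.

Lemma leq_mdeg a i : (a i <= mdeg a)%N.
Proof. by rewrite /mdeg (bigD1 i) //= leq_addr. Qed.

Lemma mdeg0 : mdeg 0 = 0%N.
Proof. by rewrite /mdeg big1// => i _; rewrite ffunE. Qed.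

Lemma mdeg_eq0 a : mdeg a = 0%N -> a = 0.
Proof.
move=> a0; apply/ffunP => i; rewrite ffunE.
by apply/eqP; rewrite -leqn0 -a0 leq_mdeg.
Qed.

Lemma mdeg_gt0 a : (0 < mdeg a)%N -> exists i, (0 < a i)%N.
Proof.
rewrite lt0n sum_nat_eq0 negb_forall => /existsP[i].
by rewrite -lt0n => ?; exists i.
Qed.

Lemma midx_ind (P : {ffun 'I_n -> nat} -> Prop) :
  P 0 -> (forall a i, P a -> P (a + munit i)) -> forall a, P a.
Proof.
move=> P0 PS a; move: {2}(mdeg a) (erefl (mdeg a)) => d.
elim: d a => [|d IH] a ad; first by rewrite (mdeg_eq0 ad).
have [i ai] : exists i, (0 < a i)%N by apply: mdeg_gt0; rewrite ad.
rewrite -(mpredK ai); apply/PS/IH.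
by move: ad; rewrite -{1}(mpredK ai) mdegS => -[].
Qed.

Definition mbox (N : nat) : seq {ffun 'I_n -> nat} :=
  [seq [ffun i => val (g i)] | g : {ffun 'I_n -> 'I_N}].

Lemma mbox_inj N :
  injective (fun g : {ffun 'I_n -> 'I_N} => [ffun i => val (g i)]).
Proof.
move=> g h /ffunP gh; apply/ffunP => i; apply: val_inj.
by have := gh i; rewrite !ffunE.
Qed.

Lemma mbox_uniq N : uniq (mbox N).
Proof. by rewrite map_inj_uniq ?enum_uniq//; exact: mbox_inj. Qed.

Lemma mem_mbox N a : (a \in mbox N) = [forall i, a i < N]%N.
Proof.
apply/mapP/forallP => [[g _ -> i]|aN]; first by rewrite ffunE /=.
exists [ffun i => Ordinal (aN i)]; first by rewrite mem_enum.
by apply/ffunP => i; rewrite !ffunE.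
Qed.

(** A cube is enough to filter from, since no exponent of a summand of [a] exceeds [mdeg a]. *)
Definition msplit a : seq ({ffun 'I_n -> nat} * {ffun 'I_n -> nat}) :=
  [seq p <- [seq (b, c) | b <- mbox (mdeg a).+1, c <- mbox (mdeg a).+1]
  | p.1 + p.2 == a].

Lemma mem_msplit p a : (p \in msplit a) = (p.1 + p.2 == a).
Proof.
rewrite mem_filter; case: eqP => //= pa.
apply/allpairsP; exists p; rewrite -surjective_pairing !mem_mbox; split=> //;
  by apply/forallP => i; rewrite ltnS (leq_trans (leq_mdeg _ i))// -pa mdegD
    ?leq_addr ?leq_addl.
Qed.

Lemma msplit_uniq a : uniq (msplit a).
Proof.
apply/filter_uniq/allpairs_uniq; rewrite ?mbox_uniq//.
by move=> [? ?] [? ?].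
Qed.

Variable R : realType.

Lemma msplit_swap (F : {ffun 'I_n -> nat} * {ffun 'I_n -> nat} -> R) a :
  \sum_(p <- msplit a) F p = \sum_(p <- msplit a) F (p.2, p.1).
Proof.
rewrite -(big_map (fun p => (p.2, p.1)) xpredT F) /=.
apply: perm_big; apply: uniq_perm; rewrite ?msplit_uniq//.
  by rewrite map_inj_uniq ?msplit_uniq// => -[? ?] [? ?] [-> ->].
move=> [b c]; rewrite mem_msplit /=; apply/idP/mapP.
  by move=> bc; exists (c, b) => //; rewrite mem_msplit addrC.
by move=> [[b' c']]; rewrite mem_msplit /= => /eqP <- [-> ->]; rewrite addrC.
Qed.

Lemma msplit_shift (F : {ffun 'I_n -> nat} * {ffun 'I_n -> nat} -> R) a i :
  (0 < a i)%N ->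
  \sum_(p <- msplit a | (0 < p.1 i)%N) F p =
  \sum_(p <- msplit (mpred i a)) F (p.1 + munit i, p.2).
Proof.
move=> ai; rewrite -(big_map (fun p => (p.1 + munit i, p.2)) xpredT F) /=.
rewrite -big_filter.
apply: perm_big; apply: uniq_perm; rewrite ?(filter_uniq _ (msplit_uniq _))//.
  rewrite map_inj_uniq ?msplit_uniq// => -[b c] [b' c'] [/= bb' ->].
  by congr pair; rewrite -(mSK b i) bb' mSK.
move=> [b c]; rewrite mem_filter mem_msplit /=; apply/idP/mapP.
  move=> /andP[bi /eqP bc]; exists (mpred i b, c) => /=; last by rewrite mpredK.
  by rewrite mem_msplit /= -bc -{2}(mpredK bi) addrAC mSK.
move=> [[b' c']]; rewrite mem_msplit /= => /eqP bc [-> ->].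
by rewrite mSE eqxx addn1 addrAC bc mpredK ?eqxx.
Qed.

(* Locked, lest unification treat a weight as a quotient. *)
Fact mweight_key : unit. Proof. exact: tt. Qed.

Definition mweight a : R :=
  locked_with mweight_key ((mdeg a)`!%:R / \prod_(i < n) (a i)`!%:R).

Lemma mweightE a : mweight a = (mdeg a)`!%:R / \prod_(i < n) (a i)`!%:R.
Proof. by rewrite /mweight unlock. Qed.

Lemma mweight0 : mweight 0 = 1.
Proof. by rewrite !mweightE mdeg0 big1 ?divr1// => i _; rewrite ffunE. Qed.

Lemma mweightS a i :
  (a i).+1%:R * mweight (a + munit i) = (mdeg a).+1%:R * mweight a.
Proof.
have f0 (m : nat) : m`!%:R != 0 :> R by rewrite pnatr_eq0 -lt0n fact_gt0.
rewrite !mweightE mdegS.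
have -> : \prod_(j < n) ((a + munit i)%R j)`!%:R = (a i).+1%:R * \prod_(j < n) (a j)`!%:R :> R.
  rewrite (bigD1 i)//= [in RHS](bigD1 i)//= mSE eqxx addn1 factS natrM mulrA.
  by congr (_ * _); apply: eq_bigr => j /negbTE ji; rewrite mSE ji addn0.
rewrite factS natrM invfM; field.
by rewrite prodf_seq_neq0 /= addrC natr1 pnatr_eq0 /= andbT; apply/allP => j _.
Qed.

Lemma mweight_ge1 a : 1 <= mweight a.
Proof.
elim/midx_ind: a => [|a i IH].
  by rewrite mweight0.
have : (a i).+1%:R * mweight a <= (a i).+1%:R * mweight (a + munit i).
  rewrite mweightS ler_wpM2r ?(le_trans _ IH)//.
  by rewrite ler_nat ltnS leq_mdeg.
by rewrite ler_pM2l ?ltr0Sn//; exact: le_trans.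
Qed.

Lemma mweight_ge0 a : 0 <= mweight a.
Proof. exact: le_trans (mweight_ge1 a). Qed.

Lemma mweight_pred a i : (0 < a i)%N ->
  (a i)%:R * mweight a = (mdeg a)%:R * mweight (mpred i a).
Proof.
move=> ai; rewrite -{1 2}(mpredK ai) mSE eqxx addn1 mweightS.
by rewrite -[in RHS](mpredK ai) mdegS mSK.
Qed.

Lemma mdeg_sumr a : (mdeg a)%:R = \sum_(i < n) (a i)%:R :> R.
Proof. by rewrite /mdeg natr_sum. Qed.

(** There are n^|a| words of length |a| on n letters. The induction removes one letter: since |a| is
    the sum of the [a i], [mweight_pred] expresses [mweight a] as the sum of the weights of the
    [mpred i a] with [0 < a i]. *)
Lemma mweight_le a : mweight a <= n%:R ^+ mdeg a.
Proof.
move: {2}(mdeg a) (erefl (mdeg a)) => d.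
elim: d a => [|d IH] a ad.
  by rewrite (mdeg_eq0 ad) mdeg0 mweight0.
have : (mdeg a)%:R * mweight a <= (mdeg a)%:R * n%:R ^+ mdeg a.
  have nE : n%:R = \sum_(i < n) 1 :> R by rewrite sumr_const card_ord.
  rewrite {1}mdeg_sumr mulr_suml {2}ad exprS {1}nE mulr_suml mulr_sumr.
  apply: ler_sum => i _.
  have [->|ai] := posnP (a i); first by rewrite mul0r !mulr_ge0// exprn_ge0.
  rewrite mweight_pred// mul1r ler_wpM2l//.
  have ad' : mdeg (mpred i a) = d.
    by move: ad; rewrite -{1}(mpredK ai) mdegS => -[].
  by rewrite (le_trans (IH _ ad'))// ad'.
by rewrite ler_pM2l// ad ltr0Sn.
Qed.

(* The number of terms times the multinomial Vandermonde identity: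
   [mweight a] counts the words of content [a], and each of these can be cut
   at [mdeg a + 1] places. *)
Lemma mweight_conv a :
  \sum_(p <- msplit a) mweight p.1 * mweight p.2 = (mdeg a).+1%:R * mweight a.
Proof.
move: {2}(mdeg a) (erefl (mdeg a)) => d.
elim: d a => [|d IH] a ad.
  rewrite (mdeg_eq0 ad) (perm_big [:: (0, 0)]) /=; last first.
    apply: uniq_perm; rewrite ?msplit_uniq// => -[b c].
    rewrite mem_msplit inE /=; apply/eqP/eqP => [bc|[-> ->]]; last exact: addr0.
    have := congr1 mdeg bc; rewrite mdegD mdeg0.
    move/eqP; rewrite addn_eq0 => /andP[/eqP b0 /eqP c0].
    by rewrite (mdeg_eq0 b0) (mdeg_eq0 c0).
  by rewrite big_seq1 /= mdeg0 mweight0 mulr1.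
have a0 : (mdeg a)%:R != 0 :> R by rewrite ad pnatr_eq0.
(* The factor |a| is distributed as the sum of the [p.1 i + p.2 i], so that [mweightS] can turn
   [p.1 i] into a degree. Adding the two forms [S1] and [S2] of the same sum yields the factor |p.1|
   + |p.2| + 2, which is constant over the decompositions. *)
apply: (mulfI a0).
transitivity (\sum_(p <- msplit a) \sum_(i < n)
    ((p.1 i)%:R + (p.2 i)%:R) * (mweight p.1 * mweight p.2)).
  rewrite mulr_sumr big_seq [RHS]big_seq; apply: eq_bigr => p.
  rewrite mem_msplit => /eqP <-; rewrite -mulr_suml mdeg_sumr; congr (_ * _).
  by apply: eq_bigr => i _; rewrite mDE natrD.
rewrite exchange_big /= mulrCA {1}mdeg_sumr mulr_suml mulr_sumr.
apply: eq_bigr => i _; under eq_bigr do rewrite mulrDl.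
rewrite big_split /=.
rewrite [X in _ + X = _]msplit_swap /=.
rewrite [X in _ + X = _](_ : _ =
  \sum_(p <- msplit a) (p.1 i)%:R * (mweight p.1 * mweight p.2)); last first.
  by apply: eq_bigr => p _; rewrite [mweight p.2 * _]mulrC.
set S := \sum_(p <- msplit a) _.
have [ai|ai] := posnP (a i).
  rewrite ai mul0r mulr0 /S big_seq big1 ?addr0// => p.
  rewrite mem_msplit => /eqP pa; have /eqP := ai; rewrite -pa mDE addn_eq0.
  by move=> /andP[/eqP -> _]; rewrite mul0r.
have ad' : mdeg (mpred i a) = d.
  by move: ad; rewrite -{1}(mpredK ai) mdegS => -[].
have S1 : S = \sum_(p <- msplit (mpred i a))
    (mdeg p.1).+1%:R * (mweight p.1 * mweight p.2).
  rewrite /S (bigID (fun p : {ffun 'I_n -> nat} * {ffun 'I_n -> nat} => 0 < p.1 i)%N) /= [X in _ + X]big1 ?addr0; last first.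
    by move=> p; rewrite -eqn0Ngt => /eqP ->; rewrite mul0r.
  rewrite msplit_shift//; apply: eq_bigr => p _ /=.
  by rewrite mSE eqxx addn1 mulrA mweightS mulrA.
have S2 : S = \sum_(p <- msplit (mpred i a))
    (mdeg p.2).+1%:R * (mweight p.1 * mweight p.2).
  rewrite S1 msplit_swap; apply: eq_bigr => p _ /=.
  by rewrite [mweight p.2 * _]mulrC.
rewrite mweight_pred// {1}S1 S2 -big_split /= ad -ad' -IH// ad'.
rewrite mulr_sumr big_seq [RHS]big_seq; apply: eq_bigr => p.
rewrite mem_msplit => /eqP pa; rewrite -mulrDl.
have -> : d = (mdeg p.1 + mdeg p.2)%N by rewrite -mdegD pa.
by congr (_ * _); rewrite -natrD addSn addnS.
Qed.

Lemma monomialD a b (x : 'rV[R]_n) : monomial (a + b) x = monomial a x * monomial b x.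
Proof. by rewrite /monomial -big_split; apply: eq_bigr => i _; rewrite mDE exprD. Qed.

Lemma monomial_unit i (x : 'rV[R]_n) : monomial (munit i) x = x 0 i.
Proof.
rewrite /monomial (bigD1 i)//= ffunE eqxx expr1 big1 ?mulr1// => j /negbTE ji.
by rewrite ffunE ji.
Qed.

Lemma monomialS a i (x : 'rV[R]_n) : monomial (a + munit i) x = monomial a x * x 0 i.
Proof. by rewrite monomialD monomial_unit. Qed.

Lemma monomial0 (x : 'rV[R]_n) : monomial 0 x = 1.
Proof. by rewrite /monomial big1// => i _; rewrite ffunE expr0. Qed.

Lemma monomial_le a (x : 'rV[R]_n) (q : R) : (forall i, `|x 0 i| <= q) ->
  `|monomial a x| <= q ^+ mdeg a.
Proof.
move=> xq; rewrite /monomial normr_prod /mdeg expr_sum.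
by apply: ler_prod => i _; rewrite normrX exprn_ge0//= lerXn2r// nnegrE ?(le_trans _ (xq i)).
Qed.

(** After enlarging [A] to a cube, the sum factors into n geometric sums in one variable, each at
    most 2. *)
Lemma mgeo_sum_le (q : R) (A : {fset {ffun 'I_n -> nat}}) : 0 <= q <= 2^-1 ->
  \sum_(a <- A) q ^+ mdeg a <= 2 ^+ n.
Proof.
move=> /andP[q0 q2]; pose N := (\max_(a <- A) mdeg a).+1.
have AN : {subset A <= mbox N}.
  move=> a aA; rewrite mem_mbox; apply/forallP => i; rewrite ltnS.
  by rewrite (leq_trans (leq_mdeg a i))//; exact: leq_bigmax_seq.
apply: (@le_trans _ _ (\sum_(a <- mbox N) q ^+ mdeg a)).
  rewrite [leRHS](bigID (mem A)) /= -[X in _ <= X + _]big_filter.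
  rewrite [X in _ <= X + _](perm_big A) /=.
    by rewrite lerDl sumr_ge0// => a _; rewrite exprn_ge0.
  apply: uniq_perm; rewrite ?filter_uniq ?mbox_uniq//.
  by move=> a; rewrite mem_filter; case: (boolP (a \in A)) => //= /AN ->.
rewrite big_map big_enum /=.
have -> : \sum_(g : {ffun 'I_n -> 'I_N}) q ^+ mdeg [ffun i => val (g i)] =
    \prod_(i < n) \sum_(k < N) q ^+ k.
  rewrite bigA_distr_bigA /=; apply: eq_bigr => g _.
  by rewrite /mdeg expr_sum; apply: eq_bigr => i _; rewrite ffunE.
rewrite prodr_const card_ord lerXn2r ?nnegrE// ?sumr_ge0// => [k _|].
  by rewrite exprn_ge0.
have S0 : 0 <= \sum_(k < N) q ^+ k by rewrite sumr_ge0// => k _; rewrite exprn_ge0.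
have := subrX1 q N; have : 0 <= q ^+ N by rewrite exprn_ge0.
nra.
Qed.

End MultiIndex.

(** * Power series in several variables *)

Lemma near0P {R : realType} {n : nat} (P : set 'rV[R]_n) :
  (\forall x \near (0 : 'rV[R]_n), P x) <->
  exists2 e : R, 0 < e & forall x : 'rV[R]_n, (forall i, `|x 0 i| < e) -> P x.
Proof.
split=> [/nbhs_ballP[e /= e0 eP]|[e e0 eP]].
  exists e => // x xe; apply: eP; split=> // i j.
  by rewrite ord1 mxE /ball /= sub0r normrN.
apply/nbhs_ballP; exists e => // x [_ xe]; apply: eP => i.
by have := xe 0 i; rewrite mxE /ball /= sub0r normrN.
Qed.

(** A single constant is both prefactor and ratio; being at least 1 it can be enlarged, so finitely
    many series share one bound. *)
Definition geo_bounded {R : realType} {n : nat} (c : {ffun 'I_n -> nat} -> R) : Prop :=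
  exists2 K, 1 <= K & forall a, `|c a| <= K ^+ (mdeg a).+1.

(** Up to unfolding, [analytic f] is the existence of [c] with [pser c f]; naming the coefficients
    allows computing with them. *)
Definition pser {R : realType} {n : nat} (c : {ffun 'I_n -> nat} -> R)
    (f : 'rV[R]_n -> R) : Prop :=
  \forall x \near (0 : 'rV[R]_n), has_sum (fun a => c a * monomial a x) (f x).

Definition dcoef {R : realType} {n : nat} (i : 'I_n) (c : {ffun 'I_n -> nat} -> R)
    (a : {ffun 'I_n -> nat}) : R :=
  (a i).+1%:R * c (a + munit i).

Definition mconv {R : realType} {n : nat} (c d : {ffun 'I_n -> nat} -> R)
    (a : {ffun 'I_n -> nat}) : R :=
  \sum_(p <- msplit a) c p.1 * d p.2.

Definition mconst {R : realType} {n : nat} (k : R) (a : {ffun 'I_n -> nat}) : R :=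
  if a == 0 then k else 0.

Definition mins {n : nat} (m : 'I_n) (b : {ffun 'I_n.-1 -> nat}) : {ffun 'I_n -> nat} :=
  [ffun i => if unlift m i is Some j then b j else 0%N].

Section PowerSeries.
Variables (R : realType) (n : nat).
Implicit Types (c d : {ffun 'I_n -> nat} -> R) (f g : 'rV[R]_n -> R).

Lemma geo_boundedI c (M K : R) : 0 <= K ->
  (forall a, `|c a| <= M * K ^+ mdeg a) -> geo_bounded c.
Proof.
move=> K0 cM; exists (1 + `|M| + K) => [|a]; first by rewrite -addrA lerDl addr_ge0.
rewrite (le_trans (cM a))// exprS.
have := ler_norm M; have := normr_ge0 M => ? ?.
apply: (@le_trans _ _ (`|M| * K ^+ mdeg a)).
  by rewrite ler_wpM2r// exprn_ge0.
apply: ler_pM => //; first exact: exprn_ge0.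
  by lra.
by apply: lerXn2r; rewrite ?nnegrE//; lra.
Qed.

Lemma geo_summable c (K : R) (x : 'rV[R]_n) : 1 <= K ->
  (forall a, `|c a| <= K ^+ (mdeg a).+1) -> (forall i, `|x 0 i| <= (2 * K)^-1) ->
  forall A : {fset {ffun 'I_n -> nat}},
  \sum_(a <- A) `|c a * monomial a x| <= K * 2 ^+ n.
Proof.
move=> K1 cK xK A.
have K0 : 0 < K by lra.
apply: (@le_trans _ _ (\sum_(a <- A) K * (2^-1) ^+ mdeg a)).
  apply: ler_sum => a _; rewrite normrM.
  apply: (@le_trans _ _ (K ^+ (mdeg a).+1 * (2 * K)^-1 ^+ mdeg a)).
    by apply: ler_pM => //; exact: monomial_le.
  rewrite exprS -mulrA ler_wpM2l ?(ltW K0)// -exprMn invfM mulrCA.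
  by rewrite divff ?mulr1// gt_eqF.
rewrite -mulr_sumr ler_wpM2l ?(ltW K0)// mgeo_sum_le//.
by apply/andP; split => //; rewrite invr_ge0.
Qed.

Lemma geo_near_summable c : geo_bounded c ->
  exists M, \forall x \near (0 : 'rV[R]_n),
    forall A : {fset {ffun 'I_n -> nat}}, \sum_(a <- A) `|c a * monomial a x| <= M.
Proof.
move=> [K K1 cK]; exists (K * 2 ^+ n); apply/near0P.
exists (2 * K)^-1; first by rewrite invr_gt0; lra.
move=> x xK; apply: geo_summable => // i; exact: ltW.
Qed.

Lemma pser_exists c : geo_bounded c -> exists f, pser c f.
Proof.
move=> /geo_near_summable[M cM].
(* The default 0 is taken only where the series has no sum, which does not happen near 0. *)
exists (fun x => xget 0 [set l | has_sum (fun a => c a * monomial a x) l]).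
apply: filterS cM => x /has_sum_exists; exact: xgetPex.
Qed.

(** Cauchy's estimate: at the diagonal point with all coordinates e/2 the terms of the series are
    bounded, and the monomial of index [a] is (e/2)^|a| there. *)
Lemma pser_geo c f : pser c f -> geo_bounded c.
Proof.
move=> /near0P[e e0 cfe].
have /has_sum_bounded[M cM] : has_sum (fun a => c a * monomial a (const_mx (e / 2)))
    (f (const_mx (e / 2))).
  by apply: cfe => i; rewrite mxE ger0_norm; lra.
apply: (@geo_boundedI _ M (2 / e)) => [|a]; first by rewrite divr_ge0// ltW.
have -> : c a = (c a * monomial a (const_mx (e / 2))) * (2 / e) ^+ mdeg a.
  rewrite -mulrA (_ : monomial _ _ = (e / 2) ^+ mdeg a).
    rewrite -exprMn mulrA divfK ?gt_eqF// divff ?gt_eqF//.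
    by rewrite expr1n mulr1.
  by rewrite /monomial /mdeg expr_sum; apply: eq_bigr => i _; rewrite mxE.
have e20 : 0 <= 2 / e by rewrite divr_ge0// ltW.
rewrite normrM normrX (ger0_norm e20).
by rewrite ler_wpM2r// exprn_ge0// divr_ge0// ltW.
Qed.

Lemma pser_ext c f g : eq_germ f g -> pser c f -> pser c g.
Proof. by apply: filterS2 => x ->. Qed.

Lemma pser_germ c f g : pser c f -> pser c g -> eq_germ f g.
Proof. by apply: filterS2 => x; exact: has_sum_unique. Qed.

Lemma pserD c d f g : pser c f -> pser d g ->
  pser (fun a => c a + d a) (fun x => f x + g x).
Proof.
apply: filterS2 => x cf dg; have := has_sumD cf dg.
by congr has_sum; apply/funext => a; rewrite mulrDl.
Qed.

Lemma pserN c f : pser c f -> pser (fun a => - c a) (fun x => - f x).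
Proof.
apply: filterS => x cf; have := has_sumN cf.
by congr has_sum; apply/funext => a; rewrite mulNr.
Qed.

Lemma pserB c d f g : pser c f -> pser d g ->
  pser (fun a => c a - d a) (fun x => f x - g x).
Proof. by move=> cf /pserN; exact: pserD. Qed.

Lemma pser_const (k : R) : pser (mconst k) ((fun=> k) : 'rV[R]_n -> R).
Proof.
apply/near0P; exists 1 => // x _; have := @has_sum1 R _ (0 : {ffun 'I_n -> nat}) k.
congr has_sum; apply/funext => a; rewrite /mconst.
by case: eqP => [->|]; rewrite ?monomial0 ?mulr1 ?mul0r.
Qed.

Lemma pser_sum (T : Type) (s : seq T) (c : T -> {ffun 'I_n -> nat} -> R)
    (f : T -> 'rV[R]_n -> R) : (forall t, pser (c t) (f t)) ->
  pser (fun a => \sum_(t <- s) c t a) (fun x => \sum_(t <- s) f t x).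
Proof.
move=> cf; elim: s => [|t s IH].
  apply: filterS (pser_const 0) => x; rewrite big_nil.
  by congr has_sum; apply/funext => a; rewrite big_nil /mconst if_same.
under eq_fun do rewrite big_cons; under [X in pser _ X]eq_fun do rewrite big_cons.
exact: pserD.
Qed.

Lemma pserM c d f g : pser c f -> pser d g ->
  pser (mconv c d) (fun x => f x * g x).
Proof.
move=> cf dg.
have [M cM] := geo_near_summable (pser_geo cf).
have [M' dM] := geo_near_summable (pser_geo dg).
apply: (filterS3 _ _ (filterI cf dg) cM dM) => x [cfx dgx] cMx dMx.
have := has_sumM cMx dMx cfx dgx.
move=> /(has_sum_fiber (p := fun p => p.1 + p.2) (@msplit_uniq n) (@mem_msplit n)).
congr has_sum; apply/funext => a; rewrite /mconv mulr_suml.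
rewrite big_seq [RHS]big_seq; apply: eq_bigr => p; rewrite mem_msplit => /eqP <-.
by rewrite monomialD mulrACA.
Qed.

(** The differential of [monomial a] at [x], applied to [h]. *)
Definition monomial_lin (x h : 'rV[R]_n) (a : {ffun 'I_n -> nat}) : R :=
  \sum_(j < n) h 0 j * ((a j)%:R * monomial (mpred j a) x).

Lemma monomial_linS x h a i : monomial_lin x h (a + munit i) = h 0 i * monomial a x + x 0 i * monomial_lin x h a.
Proof.
rewrite /monomial_lin; transitivity (\sum_(j < n) (h 0 j * ((a j)%:R * (monomial (mpred j a) x * x 0 i)) +
    (if j == i then h 0 i * monomial a x else 0))).
  apply: eq_bigr => j _; rewrite mSE natrD mulrDl mulrDr.
  congr (_ + _); last first.
    by case: eqP => [->|_]; rewrite ?mul1r ?mSK// mul0r mulr0.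
  have [->|aj] := posnP (a j); first by rewrite !mul0r.
  rewrite -monomialS; congr (_ * (_ * monomial _ _)).
  by rewrite -{1}(mpredK aj) addrAC mSK.
rewrite big_split /= addrC -big_mkcond big_pred1_eq; congr (_ + _).
by rewrite mulr_sumr; apply: eq_bigr => j _; ring.
Qed.

(** The mean value estimate |a| eta rho^(|a|-1), multiplied by rho to avoid a truncated exponent;
    the next lemma is multiplied by rho^2 for the same reason. *)
Lemma monomial_lip (x h : 'rV[R]_n) (a : {ffun 'I_n -> nat}) (rho eta : R) : 0 < rho -> 0 <= eta ->
  (forall i, `|x 0 i| <= rho) -> (forall i, `|(x + h) 0 i| <= rho) ->
  (forall i, `|h 0 i| <= eta) ->
  rho * `|monomial a (x + h) - monomial a x| <= (mdeg a)%:R * eta * rho ^+ mdeg a.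
Proof.
move=> r0 eta0 xr xhr he; elim/midx_ind: a => [|a i IH].
  by rewrite !monomial0 subrr normr0 mulr0 mdeg0 !mul0r.
rewrite !monomialS mdegS.
have -> : monomial a (x + h) * (x + h) 0 i - monomial a x * x 0 i =
  (monomial a (x + h) - monomial a x) * (x + h) 0 i + monomial a x * h 0 i.
  by rewrite mxE; ring.
rewrite (le_trans (ler_wpM2l (ltW r0) (ler_normD _ _)))// !normrM mulrDr.
apply: (@le_trans _ _ ((mdeg a)%:R * eta * rho ^+ mdeg a * rho + rho * (rho ^+ mdeg a * eta))).
  apply: lerD; first by rewrite mulrA ler_pM// mulr_ge0// ltW.
  by rewrite ler_wpM2l ?(ltW r0)// ler_pM// monomial_le.
by rewrite -natr1 exprS; apply: eq_ler; ring.
Qed.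

Lemma monomial_taylor (x h : 'rV[R]_n) (a : {ffun 'I_n -> nat}) (rho eta : R) : 0 < rho -> 0 <= eta ->
  (forall i, `|x 0 i| <= rho) -> (forall i, `|(x + h) 0 i| <= rho) ->
  (forall i, `|h 0 i| <= eta) ->
  rho ^+ 2 * `|monomial a (x + h) - monomial a x - monomial_lin x h a| <=
  (mdeg a)%:R ^+ 2 * eta ^+ 2 * rho ^+ mdeg a.
Proof.
move=> r0 eta0 xr xhr he; elim/midx_ind: a => [|a i IH].
  rewrite !monomial0 subrr sub0r /monomial_lin big1 ?oppr0 ?normr0 ?mulr0//.
    by rewrite mdeg0 expr0n /= !mul0r.
  by move=> j _; rewrite ffunE mul0r mulr0.
rewrite monomial_linS !monomialS mdegS.
have -> : monomial a (x + h) * (x + h) 0 i - monomial a x * x 0 i -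
    (h 0 i * monomial a x + x 0 i * monomial_lin x h a) =
  x 0 i * (monomial a (x + h) - monomial a x - monomial_lin x h a) +
  h 0 i * (monomial a (x + h) - monomial a x).
  by rewrite [(x + h) 0 i]mxE; ring.
rewrite (le_trans (ler_wpM2l (exprn_ge0 _ (ltW r0)) (ler_normD _ _)))// !normrM mulrDr.
have lip := monomial_lip a r0 eta0 xr xhr he.
apply: (@le_trans _ _ (rho * ((mdeg a)%:R ^+ 2 * eta ^+ 2 * rho ^+ mdeg a) +
    rho * eta * ((mdeg a)%:R * eta * rho ^+ mdeg a))).
  apply: lerD.
    by rewrite mulrCA ler_pM// mulr_ge0// exprn_ge0// ltW.
  rewrite expr2 -mulrA -mulrA ler_wpM2l ?(ltW r0)// mulrCA ler_pM//.
  by rewrite mulr_ge0// ltW.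
rewrite -natr1 [rho ^+ _.+1]exprS.
set D := (mdeg a)%:R; set P := rho ^+ mdeg a.
rewrite -subr_ge0 (_ : _ - _ = (D + 1) * eta ^+ 2 * (rho * P)); last by ring.
by rewrite /P !mulr_ge0 ?exprn_ge0 ?addr_ge0 ?(ltW r0).
Qed.

Lemma sqr_le_expr4 (d : nat) : d%:R ^+ 2 <= 4 ^+ d :> R.
Proof.
rewrite -natrX -natrX ler_nat (_ : 4 = 2 ^ 2)%N// -expnM mulnC expnM.
by rewrite leq_exp2r// ltnW// ltn_expl.
Qed.

Lemma geo_dcoef c i : geo_bounded c -> geo_bounded (dcoef i c).
Proof.
move=> [K K1 cK]; apply: (@geo_boundedI _ (2 * K ^+ 2) (2 * K)) => [|a]; first by lra.
rewrite /dcoef normrM normr_nat.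
apply: (@le_trans _ _ (2 ^+ (mdeg a).+1 * K ^+ (mdeg a).+2)).
  apply: ler_pM => //; last by rewrite (le_trans (cK _))// mdegS.
  by rewrite -natrX ler_nat (leq_trans (ltn_expl (a i) (ltnSn 1)))// leq_exp2l// leqW// leq_mdeg.
by rewrite exprMn !exprS; apply: eq_ler; ring.
Qed.

Lemma has_sum_dcoef c i x l : has_sum (fun a => dcoef i c a * monomial a x) l ->
  has_sum (fun a => c a * ((a i)%:R * monomial (mpred i a) x)) l.
Proof.
move=> /(has_sum_fiber (p := fun a => a + munit i)
  (fib := fun a => if (0 < a i)%N then [:: mpred i a] else [::])).
move=> /(_ _ _)/wrap[a|a b|].
- by case: ifP.
- case: ifP => bi.
    rewrite inE; apply/eqP/eqP => [->|<-]; first by rewrite mpredK.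
    by rewrite mSK.
  by apply/esym/eqP => ab; move: bi; rewrite -ab mSE eqxx addn1.
congr has_sum; apply/funext => a.
case: ifP => ai; last first.
  by move/negbT: ai; rewrite -eqn0Ngt => /eqP ->; rewrite big_nil mul0r mulr0.
rewrite big_seq1 /dcoef mpredK// -[X in X%:R](_ : a i = _); first by ring.
by rewrite -{1}(mpredK ai) mSE eqxx addn1.
Qed.

(** A quadratic remainder bound, uniform in [x], obtained by summing [monomial_taylor] over the
    series. It yields all directional derivatives near 0 at once. *)
Lemma pser_taylor c f : pser c f ->
  exists2 g : 'I_n -> 'rV[R]_n -> R, (forall i, pser (dcoef i c) (g i)) &
  exists (rho C : R), [/\ 0 < rho, 0 <= C & forall (x h : 'rV[R]_n) eta,
    (forall i, `|x 0 i| <= rho) -> (forall i, `|(x + h) 0 i| <= rho) ->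
    (forall i, `|h 0 i| <= eta) -> 0 <= eta ->
    `|f (x + h) - f x - \sum_(i < n) h 0 i * g i x| <= C * eta ^+ 2].
Proof.
move=> cf; have cgeo := pser_geo cf.
have /choice[g cg] : forall i, exists gi, pser (dcoef i c) gi.
  by move=> i; apply/pser_exists/geo_dcoef.
exists g => //; have [K K1 cK] := cgeo.
have /near0P[e e0 efg] : \forall x \near (0 : 'rV[R]_n),
    has_sum (fun a => c a * monomial a x) (f x) /\
    forall i, has_sum (fun a => dcoef i c a * monomial a x) (g i x).
  apply: filterI => //; apply: (filter_forall (F := nbhs (0 : 'rV[R]_n))
      (f := fun i x => has_sum (fun a => dcoef i c a * monomial a x) (g i x))) => i.
    exact: cg.
(* The first bound stays inside the domain of convergence. The second makes the ratio [4 * K * rho]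
   at most 1/2, where 4 absorbs the factor |a|^2 of the Taylor bound and [K] the growth of the
   coefficients. *)
pose rho := Num.min (e / 2) (8 * K)^-1.
have r0 : 0 < rho by rewrite lt_min invr_gt0; apply/andP; split; lra.
have re : rho < e by rewrite gt_min; apply/orP; left; lra.
have rK : 4 * K * rho <= 2^-1.
  have rK : rho <= (8 * K)^-1 by rewrite ge_min lexx orbT.
  have K8 : 0 < 8 * K by lra.
  by move: rK; rewrite -(ler_pM2l K8 rho) divff ?gt_eqF//; lra.
exists rho, (K * 2 ^+ n / rho ^+ 2); split=> //.
  by rewrite divr_ge0 ?exprn_ge0 ?mulr_ge0 ?exprn_ge0//; lra.
move=> x h eta xr xhr he eta0.
have [fx gx] := efg x (fun i => le_lt_trans (xr i) re).
have [fxh _] := efg (x + h) (fun i => le_lt_trans (xhr i) re).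
have S : has_sum (fun a => c a * (monomial a (x + h) - monomial a x - monomial_lin x h a))
    (f (x + h) - f x - \sum_(i < n) h 0 i * g i x).
  have lingx : has_sum (fun a => c a * monomial_lin x h a) (\sum_(i < n) h 0 i * g i x).
    have := has_sum_sum (s := index_enum 'I_n) (fun i => has_sumZ (k := h 0 i) (has_sum_dcoef (gx i))).
    congr has_sum; apply/funext => a; rewrite /monomial_lin mulr_sumr.
    by apply: eq_bigr => i _; ring.
  have := has_sumD (has_sumD fxh (has_sumN fx)) (has_sumN lingx).
  by congr has_sum; apply/funext => a; ring.
apply: (has_sum_le S) => A; rewrite (le_trans (ler_norm_sum _ _ _))//.
apply: (@le_trans _ _ (\sum_(a <- A) (K / rho ^+ 2 * eta ^+ 2) * (4 * K * rho) ^+ mdeg a)).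
  apply: ler_sum => a _; rewrite normrM.
  have T := monomial_taylor a r0 eta0 xr xhr he.
  have r20 : 0 < rho ^+ 2 by rewrite exprn_gt0.
  rewrite -(ler_pM2l r20) mulrCA.
  apply: (@le_trans _ _ (K ^+ (mdeg a).+1 * (4 ^+ mdeg a * eta ^+ 2 * rho ^+ mdeg a))).
    apply: ler_pM => //; first by rewrite mulr_ge0// ltW.
    apply: (le_trans T); apply: ler_wpM2r; first by rewrite exprn_ge0// ltW.
    by apply: ler_wpM2r; rewrite ?exprn_ge0// sqr_le_expr4.
  rewrite !exprMn exprS; apply: eq_ler; field.
  by rewrite gt_eqF.
rewrite -mulr_sumr (le_trans (ler_wpM2l _ (mgeo_sum_le _ _)))//.
- by rewrite mulr_ge0 ?exprn_ge0// divr_ge0 ?exprn_ge0//; lra.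
- by rewrite rK andbT !mulr_ge0//; lra.
by apply: eq_ler; ring.
Qed.

Lemma pser_cvg_derive c f : pser c f ->
  exists2 g : 'I_n -> 'rV[R]_n -> R, (forall i, pser (dcoef i c) (g i)) &
  \forall x \near (0 : 'rV[R]_n), forall v : 'rV[R]_n,
    (h^-1 *: ((f \o shift x) (h *: v) - f x)) @[h --> 0^'] -->
    \sum_(i < n) v 0 i * g i x.
Proof.
move=> /pser_taylor[g cg [rho [C [r0 C0 T]]]]; exists g => //.
apply/near0P; exists (rho / 2); first by lra.
move=> x xr v.
pose V := 1 + \sum_(i < n) `|v 0 i|.
have V1 : 1 <= V by rewrite lerDl sumr_ge0.
have vV i : `|v 0 i| <= V.
  by rewrite /V (bigD1 i)//= addrCA lerDl addr_ge0// sumr_ge0.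
apply/cvgrPdist_lt => e e0.
(* The first bound on [h] keeps [x + h *: v] within [rho]; the second makes the remainder divided by
   [|h|] smaller than [e]. *)
have d0 : 0 < Num.min (rho / 2 / V) (e / (C * V ^+ 2 + 1)).
  rewrite lt_min !divr_gt0//; try lra.
  by rewrite ltr_wpDl// mulr_ge0// exprn_ge0//; lra.
near=> h.
have h0 : h != 0 by near: h; exact: nbhs_dnbhs_neq.
have : `|h| < Num.min (rho / 2 / V) (e / (C * V ^+ 2 + 1)).
  by near: h; exact: dnbhs0_lt.
have CV : 0 < C * V ^+ 2 + 1 by rewrite ltr_wpDl// mulr_ge0// exprn_ge0//; lra.
rewrite lt_min => /andP[hr he] /=.
rewrite ltr_pdivlMr in hr; last by lra.
rewrite ltr_pdivlMr// in he.
have hv i : `|(h *: v) 0 i| <= `|h| * V by rewrite mxE normrM ler_wpM2l.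
have := T x (h *: v) (`|h| * V) (fun i => ltW (lt_le_trans (xr i) _)) _ hv _.
move=> /(_ ltac:(lra)) /(_ _ _)/wrap[i||].
- rewrite mxE (le_trans (ler_normD _ _))//.
  by have := xr i; have := hv i; lra.
- by rewrite mulr_ge0//; lra.
move=> {}T.
have -> : \sum_(i < n) v 0 i * g i x - h^-1 *: (f (h *: v + x) - f x) =
   - (h^-1 * (f (x + h *: v) - f x - \sum_(i < n) (h *: v) 0 i * g i x)).
  under [X in _ = - (_ * (_ - X))]eq_bigr do rewrite mxE -mulrA.
  rewrite -mulr_sumr [h *: v + x]addrC mulrBr mulKf// opprB.
  by congr (_ - _).
rewrite normrN normrM normfV -ltr_pdivlMl ?invr_gt0 ?normr_gt0// invrK.
apply: le_lt_trans T _.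
have hp : 0 < `|h| by rewrite normr_gt0.
have -> : C * (`|h| * V) ^+ 2 = `|h| * (`|h| * (C * V ^+ 2)) by ring.
rewrite ltr_pM2l//; apply: le_lt_trans he.
by rewrite ler_wpM2l ?(ltW hp)// lerDl.
Unshelve. all: by end_near. Qed.

Lemma derive_sum_basis c f : pser c f ->
  \forall x \near (0 : 'rV[R]_n), forall v : 'rV[R]_n,
    derivable f x v /\ 'D_v f x = \sum_(i < n) v 0 i * 'D_(basis_vec i) f x.
Proof.
move=> /pser_cvg_derive[g cg]; apply: filterS => x D v; split.
  by apply/cvg_ex; eexists; exact: D.
rewrite [LHS](cvg_lim _ (D v))//; apply: eq_bigr => i _; congr (_ * _).
rewrite /derive (cvg_lim _ (D _))// (bigD1 i)//= big1 ?addr0.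
  by rewrite mxE !eqxx mul1r.
by move=> j /negbTE ji; rewrite mxE ji andbF mul0r.
Qed.

Lemma pser_derive c f i : pser c f ->
  pser (dcoef i c) (fun x => 'D_(basis_vec i) f x).
Proof.
move=> /pser_cvg_derive[g cg D]; apply: pser_ext (cg i).
apply: filterS D => x D.
rewrite /derive (cvg_lim _ (D _))// (bigD1 i)//= big1 ?addr0.
  by rewrite mxE !eqxx mul1r.
by move=> j /negbTE ji; rewrite mxE ji andbF mul0r.
Qed.

Lemma eq_germ_derive f g v : eq_germ f g -> eq_germ (fun x => 'D_v f x) (fun x => 'D_v g x).
Proof. by move=> /near_join; apply: filterS => x; exact: near_eq_derive. Qed.

(** Evaluation at 0 gives the constant coefficient. The derivatives of [f] have zero germ too, and
    their coefficients are nonzero multiples of the shifted ones, hence the induction on [a] for all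
    series at once. *)
Lemma pser_eq0 c f : pser c f -> eq_germ f (fun=> 0) -> forall a, c a = 0.
Proof.
move=> cf f0 a; move: a c f cf f0.
apply: midx_ind => [|a i IH] c f cf f0.
  have := nbhs_singleton cf; rewrite (nbhs_singleton f0) => c0.
  apply: has_sum_unique c0.
  have := @has_sum1 R _ (0 : {ffun 'I_n -> nat}) (c (0 : {ffun 'I_n -> nat})).
  congr has_sum; apply/funext => a; case: eqP => [->|/eqP a0].
    by rewrite monomial0 mulr1.
  have [i ai] : exists i, (0 < a i)%N.
    apply: mdeg_gt0; rewrite lt0n; apply: contra a0 => /eqP/mdeg_eq0 ->.
    exact: eqxx.
  by rewrite -(mpredK ai) monomialS mxE !mulr0.
have := IH _ _ (pser_derive i cf).
move=> /(_ _)/wrap[|].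
  apply: filterS (eq_germ_derive (basis_vec i) f0) => x ->.
  exact: derive_cst.
by move=> /eqP; rewrite mulf_eq0 pnatr_eq0 /= => /eqP.
Qed.

Lemma pser_inj c d f : pser c f -> pser d f -> c = d.
Proof.
move=> cf df; apply/funext => a; apply/eqP; rewrite -subr_eq0; apply/eqP.
apply: (pser_eq0 (pserB cf df)).
by apply/near0P; exists 1 => // x _; rewrite subrr.
Qed.

Lemma near_hyperplane (m : 'I_n) (P : set 'rV[R]_n) :
  (\forall x \near (0 : 'rV[R]_n), P x) ->
  \forall y \near (0 : 'rV[R]_n.-1), P (hyperplane m y).
Proof.
move=> /near0P[e e0 eP]; apply/near0P; exists e => // y ye; apply: eP => i.
by rewrite mxE; case: unliftP => [j _|_]; rewrite ?normr0.
Qed.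

Lemma monomial_hyperplane (m : 'I_n) (b : {ffun 'I_n.-1 -> nat}) (y : 'rV[R]_n.-1) :
  monomial (mins m b) (hyperplane m y) = monomial b y.
Proof.
rewrite /monomial (bigD1_ord m) //= ffunE unlift_none expr0 mul1r.
by apply: eq_bigr => j _; rewrite ffunE mxE liftK.
Qed.
End PowerSeries.

(** The restricted series has some sum by its coefficient bound. Extended by zero to all
    multi-indices, it is the full series on the hyperplane, where monomials with a positive exponent
    at [m] vanish; uniqueness identifies the sums. *)
Lemma pser_hyperplane {R : realType} {n : nat} (m : 'I_n)
    (c : {ffun 'I_n -> nat} -> R) (f : 'rV[R]_n -> R) :
  pser c f -> pser (c \o mins m) (f \o hyperplane m).
Proof.
move=> cf.
have mdeg_ins b : mdeg (mins m b) = mdeg b.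
  rewrite /mdeg (bigD1_ord m) //= ffunE unlift_none add0n.
  by apply: eq_bigr => j _; rewrite ffunE liftK.
have [M cM] : exists M, \forall y \near (0 : 'rV[R]_n.-1),
    forall A : {fset _}, \sum_(a <- A) `|(c \o mins m) a * monomial a y| <= M.
  apply: geo_near_summable; have [K K1 cK] := pser_geo cf.
  by exists K => // b; rewrite /= -mdeg_ins.
apply: filterS2 (near_hyperplane m cf) cM => y cfy /has_sum_exists[l hl].
rewrite /= -[f _](has_sum_unique _ cfy (l := l))//.
have := has_sum_fiber (p := mins m)
  (fib := fun a => if a m == 0%N then [:: [ffun j => a (lift m j)]] else [::]) _ _ hl.
move=> /(_ _ _)/wrap[a|b a|].
- by case: ifP.
- case: ifP => am.
    rewrite inE; apply/eqP/eqP => [->|<-].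
      apply/ffunP => i; rewrite ffunE; case: unliftP => [j ->|->].
        by rewrite ffunE.
      by rewrite (eqP am).
    by apply/ffunP => j; rewrite !ffunE liftK.
  by apply/esym/eqP => ba; move: am; rewrite -ba ffunE unlift_none.
congr has_sum; apply/funext => a; case: ifP => am.
  rewrite big_seq1 /=; set b := finfun _.
  suff -> : a = mins m b by rewrite monomial_hyperplane.
  apply/ffunP => i; rewrite ffunE; case: unliftP => [j ->|->].
    by rewrite ffunE.
  by rewrite (eqP am).
rewrite big_nil /monomial (bigD1 m)//= mxE unlift_none.
by rewrite expr0n am mul0r mulr0.
Qed.

(** * Connections and Christoffel symbols *)

Section Connections.
Variables (R : realType) (n : nat).
Implicit Types (f g : 'rV[R]_n -> R) (X Y : vfield R n) (nabla : connop R n).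

Lemma analytic_const (k : R) : analytic ((fun=> k) : 'rV[R]_n -> R).
Proof. by exists (mconst k); exact: pser_const. Qed.

Lemma analyticD f g : analytic f -> analytic g -> analytic (fun x => f x + g x).
Proof. by move=> [c cf] [d dg]; eexists; exact: (pserD cf dg). Qed.

Lemma analyticM f g : analytic f -> analytic g -> analytic (fun x => f x * g x).
Proof. by move=> [c cf] [d dg]; eexists; exact: (pserM cf dg). Qed.

Lemma analytic_derive f i : analytic f -> analytic (fun x => 'D_(basis_vec i) f x).
Proof. by move=> [c cf]; eexists; exact: (pser_derive i cf). Qed.

Lemma analytic_sum (T : Type) (s : seq T) (f : T -> 'rV[R]_n -> R) :
  (forall t, analytic (f t)) -> analytic (fun x => \sum_(t <- s) f t x).
Proof. by move=> /choice[c cf]; eexists; exact: (pser_sum s cf). Qed.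

Lemma coord_field_analytic i : analytic_vfield (@coord_field R n i).
Proof. by move=> k; exact: analytic_const. Qed.

Lemma near_derivable Y : analytic_vfield Y ->
  \forall x \near (0 : 'rV[R]_n), forall k v, derivable (fun z => Y z 0 k) x v.
Proof.
move=> aY; apply: (filter_forall (F := nbhs (0 : 'rV[R]_n))
  (f := fun k x => forall v, derivable (fun z => Y z 0 k) x v)) => k.
have [c cY] := aY k; apply: filterS (derive_sum_basis cY) => x D v.
by have [] := D v.
Qed.

Definition conn_of (G : 'I_n * 'I_n * 'I_n -> 'rV[R]_n -> R) : connop R n :=
  fun X Y x => \row_k (\sum_(i < n) X x 0 i * 'D_(basis_vec i) (fun z => Y z 0 k) x
    + \sum_(i < n) \sum_(j < n) X x 0 i * Y x 0 j * G (k, i, j) x).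

Lemma conn_of_connection (G : 'I_n * 'I_n * 'I_n -> 'rV[R]_n -> R) :
  (forall s, analytic (G s)) -> is_connection (conn_of G).
Proof.
move=> aG; split.
- move=> X Y aX aY k; under eq_fun do rewrite mxE.
  apply: analyticD; apply: analytic_sum => i.
    by apply: analyticM => //; exact: analytic_derive.
  by apply: analytic_sum => j; apply: analyticM => //; exact: analyticM.
- move=> X X' Y Y' _ _ _ _ XX' /near_join YY'.
  apply: filterS2 XX' YY' => x Xx YY'.
  apply/rowP => k; rewrite !mxE Xx (nbhs_singleton YY'); congr (_ + _).
  apply: eq_bigr => i _; congr (_ * _); apply: near_eq_derive.
  by apply: filterS YY' => z ->.
- move=> X X' Y _ _ _; apply/near0P; exists 1 => // x _.
  apply/rowP => k; rewrite !mxE [RHS]addrACA; congr (_ + _); rewrite -big_split /=.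
    by apply: eq_bigr => i _; rewrite mxE mulrDl.
  apply: eq_bigr => i _; rewrite -big_split /=; apply: eq_bigr => j _.
  by rewrite mxE !mulrDl.
- move=> f X Y _ _ _; apply/near0P; exists 1 => // x _.
  apply/rowP => k; rewrite !mxE mulrDr !mulr_sumr; congr (_ + _).
    by apply: eq_bigr => i _; rewrite mxE mulrA.
  apply: eq_bigr => i _; rewrite mulr_sumr; apply: eq_bigr => j _.
  by rewrite mxE !mulrA.
- move=> X Y Y' aX aY aY'.
  apply: filterS2 (near_derivable aY) (near_derivable aY') => x dY dY'.
  apply/rowP => k; rewrite !mxE [RHS]addrACA; congr (_ + _); rewrite -big_split /=.
    apply: eq_bigr => i _; rewrite -mulrDr; congr (_ * _).
    rewrite -(deriveD (dY k _) (dY' k _)); congr ('D_ _ _ _).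
    by apply/funext => z; rewrite mxE.
  apply: eq_bigr => i _; rewrite -big_split /=; apply: eq_bigr => j _.
  by rewrite mxE mulrDr !mulrDl.
- move=> f X Y [c cf] aX aY.
  apply: filterS2 (near_derivable aY) (derive_sum_basis cf) => x dY df.
  have [_ Df] := df (X x).
  apply/rowP => k; rewrite !mxE mulrDr addrA; congr (_ + _).
    rewrite Df mulr_suml mulr_sumr -big_split /=; apply: eq_bigr => i _.
    have [dfi _] := df (basis_vec i).
    have -> : (fun z => (f z *: Y z) 0 k) = f * (fun z => Y z 0 k).
      by apply/funext => z; rewrite mxE.
    by rewrite (deriveM dfi (dY k _)) /GRing.scale /=; ring.
  rewrite mulr_sumr; apply: eq_bigr => i _; rewrite mulr_sumr.
  by apply: eq_bigr => j _; rewrite mxE; ring.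
Qed.

Lemma christoffel_conn_of (G : 'I_n * 'I_n * 'I_n -> 'rV[R]_n -> R) k i j :
  christoffel (conn_of G) k i j = G (k, i, j).
Proof.
apply/funext => x; rewrite /christoffel mxE big1 ?add0r; last first.
  by move=> l _; rewrite (_ : (fun z => _) = cst (basis_vec j 0 k))// derive_cst mulr0.
rewrite (bigD1 i)//= [X in _ + X]big1 ?addr0; last first.
  move=> l /negbTE li; rewrite big1// => l' _.
  by rewrite /coord_field /basis_vec [delta_mx _ i _ _]mxE li andbF !mul0r.
rewrite (bigD1 j)//= [X in _ + X]big1 ?addr0; last first.
  move=> l /negbTE lj.
  by rewrite /coord_field /basis_vec [delta_mx _ j _ _]mxE lj andbF mulr0 mul0r.
by rewrite /coord_field /basis_vec !mxE !eqxx !mul1r.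
Qed.

Lemma connection_suml nabla (f : 'I_n -> 'rV[R]_n -> R) Y (s : seq 'I_n) :
  is_connection nabla -> (forall i, analytic (f i)) -> analytic_vfield Y ->
  eq_germ (nabla (fun x => \sum_(i <- s) f i x *: basis_vec i) Y)
    (fun x => \sum_(i <- s) f i x *: nabla (coord_field i) Y x).
Proof.
move=> cn af aY; elim: s => [|i s IH].
  (* The empty sum is not covered by additivity; it is written as the zero function times a
     field. *)
  have := conn_scalel cn (analytic_const 0) aY aY.
  rewrite (_ : (fun x => 0 *: Y x) = fun x => \sum_(i <- [::]) f i x *: basis_vec i).
    by apply: filterS => x ->; rewrite scale0r big_nil.
  by apply/funext => x; rewrite scale0r big_nil.
have aE : analytic_vfield (fun x => f i x *: basis_vec i).
  by move=> k; under eq_fun do rewrite mxE; apply: analyticM => //; exact: analytic_const.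
have aS : analytic_vfield (fun x => \sum_(i <- s) f i x *: basis_vec i).
  move=> k; under eq_fun do rewrite summxE; apply: analytic_sum => j.
  by under eq_fun do rewrite mxE; apply: analyticM => //; exact: analytic_const.
under [X in nabla X]eq_fun do rewrite big_cons.
have h1 := conn_addl cn aE aS aY.
have h2 := conn_scalel cn (af i) (@coord_field_analytic i) aY.
apply: filterS3 h1 h2 IH => x h1 h2 h3.
by rewrite h1 h2 h3 big_cons.
Qed.

Lemma connection_sumr nabla i (f : 'I_n -> 'rV[R]_n -> R) (s : seq 'I_n) :
  is_connection nabla -> (forall j, analytic (f j)) ->
  eq_germ (nabla (coord_field i) (fun x => \sum_(j <- s) f j x *: basis_vec j))
    (fun x => \sum_(j <- s) ('D_(basis_vec i) (f j) x *: basis_vec j +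
                             f j x *: nabla (coord_field i) (coord_field j) x)).
Proof.
move=> cn af; have ai := @coord_field_analytic i; elim: s => [|j s IH].
  have := conn_leibniz cn (analytic_const 0) ai ai.
  rewrite (_ : (fun x => 0 *: _) = fun x => \sum_(j <- [::]) f j x *: basis_vec j).
    apply: filterS => x ->; rewrite scale0r big_nil addr0.
    by rewrite (_ : 'D_ _ _ _ = 0) ?scale0r//; exact: derive_cst.
  by apply/funext => x; rewrite scale0r big_nil.
have aE : analytic_vfield (fun x => f j x *: basis_vec j).
  by move=> k; under eq_fun do rewrite mxE; apply: analyticM => //; exact: analytic_const.
have aS : analytic_vfield (fun x => \sum_(j <- s) f j x *: basis_vec j).
  move=> k; under eq_fun do rewrite summxE; apply: analytic_sum => l.
  by under eq_fun do rewrite mxE; apply: analyticM => //; exact: analytic_const.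
under [X in nabla _ X]eq_fun do rewrite big_cons.
have h1 := conn_addr cn ai aE aS.
have h2 := conn_leibniz cn (af j) ai (@coord_field_analytic j).
apply: filterS3 h1 h2 IH => x h1 h2 h3.
by rewrite h1 h2 h3 big_cons.
Qed.

(** Expanding both fields in the coordinate basis, by linearity over functions in [X] and the
    Leibniz rule in [Y], recovers an abstract operator from its symbols. *)
Lemma connectionE nabla X Y : is_connection nabla ->
  analytic_vfield X -> analytic_vfield Y ->
  eq_germ (nabla X Y)
    (conn_of (fun s => christoffel nabla s.1.1 s.1.2 s.2) X Y).
Proof.
move=> cn aX aY.
have XE : X = fun x => \sum_(i < n) X x 0 i *: basis_vec i.
  by apply/funext => x; rewrite {1}[X x]row_sum_delta.
have YE : Y = fun x => \sum_(i < n) Y x 0 i *: basis_vec i.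
  by apply/funext => x; rewrite {1}[Y x]row_sum_delta.
have h1 := connection_suml (index_enum _) cn aX aY.
have h2 : \forall x \near (0 : 'rV[R]_n), forall i,
    nabla (coord_field i) Y x = \sum_(j < n) ('D_(basis_vec i) (fun z => Y z 0 j) x *: basis_vec j +
                             Y x 0 j *: nabla (coord_field i) (coord_field j) x).
  apply: (filter_forall (F := nbhs (0 : 'rV[R]_n)) (f := fun i x =>
    nabla (coord_field i) Y x = \sum_(j < n) ('D_(basis_vec i) (fun z => Y z 0 j) x *: basis_vec j +
                             Y x 0 j *: nabla (coord_field i) (coord_field j) x))) => i.
  have := connection_sumr i (index_enum _) cn aY.
  by rewrite -YE.
rewrite -XE in h1.
apply: filterS2 h1 h2 => x -> h2.
apply/rowP => k; rewrite summxE mxE -big_split /=; apply: eq_bigr => i _.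
rewrite mxE h2 summxE mulr_sumr.
transitivity (\sum_(j < n) (X x 0 i * 'D_(basis_vec i) (fun z => Y z 0 j) x * (k == j)%:R +
    X x 0 i * (Y x 0 j * christoffel nabla k i j x))).
  by apply: eq_bigr => j _; rewrite !mxE eqxx /= mulrDr !mulrA.
rewrite big_split /=; congr (_ + _).
  rewrite (bigD1 k)//= eqxx mulr1 big1 ?addr0// => j /negbTE jk.
  by rewrite eq_sym jk mulr0.
by apply: eq_bigr => j _; rewrite mulrA.
Qed.

Lemma connection_ext nabla nabla' : is_connection nabla -> is_connection nabla' ->
  (forall k i j, eq_germ (christoffel nabla k i j) (christoffel nabla' k i j)) ->
  eq_connection nabla nabla'.
Proof.
move=> cn cn' GG' X Y aX aY.
have H : \forall x \near (0 : 'rV[R]_n), forall s : 'I_n * 'I_n * 'I_n,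
    christoffel nabla s.1.1 s.1.2 s.2 x = christoffel nabla' s.1.1 s.1.2 s.2 x.
  apply: (filter_forall (F := nbhs (0 : 'rV[R]_n)) (f := fun s x =>
    christoffel nabla s.1.1 s.1.2 s.2 x = christoffel nabla' s.1.1 s.1.2 s.2 x)) => s.
  exact: GG'.
apply: filterS3 (connectionE cn aX aY) (connectionE cn' aX aY) H => x -> -> H.
apply/rowP => k; rewrite !mxE; congr (_ + _).
apply: eq_bigr => i _; apply: eq_bigr => j _; congr (_ * _).
exact: (H (k, i, j)).
Qed.

Lemma christoffel_analytic nabla k i j : is_connection nabla ->
  analytic (christoffel nabla k i j).
Proof. by move=> cn; exact: (conn_analytic cn (coord_field_analytic i) (coord_field_analytic j)). Qed.

Definition ricci_coef (c : 'I_n * 'I_n * 'I_n -> {ffun 'I_n -> nat} -> R)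
    (i j : 'I_n) (a : {ffun 'I_n -> nat}) : R :=
  \sum_(k < n) (dcoef k (c (k, i, j)) a - dcoef i (c (k, k, j)) a) +
  \sum_(k < n) \sum_(l < n) (mconv (c (l, i, j)) (c (k, k, l)) a
                             - mconv (c (l, k, j)) (c (k, i, l)) a).

Lemma pser_ricci nabla (c : 'I_n * 'I_n * 'I_n -> {ffun 'I_n -> nat} -> R) i j :
  (forall s, pser (c s) (christoffel nabla s.1.1 s.1.2 s.2)) ->
  pser (ricci_coef c i j) (fun x => ricci nabla x i j).
Proof.
move=> cG; under eq_fun do rewrite mxE.
apply: pserD; apply: pser_sum => k.
  by apply: pserB; apply: pser_derive;
     [exact: (cG (k, i, j))|exact: (cG (k, k, j))].
apply: pser_sum => l.
apply: pserB; apply: pserM.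
- exact: (cG (l, i, j)).
- exact: (cG (k, k, l)).
- exact: (cG (l, k, j)).
- exact: (cG (k, i, l)).
Qed.

(** Uniqueness of coefficients makes the differential equation a purely algebraic system, separating
    the recursion from questions of convergence. *)
Lemma ricci_eq_germP nabla (r : tensor02 R n)
    (c : 'I_n * 'I_n * 'I_n -> {ffun 'I_n -> nat} -> R)
    (rc : 'I_n -> 'I_n -> {ffun 'I_n -> nat} -> R) :
  (forall s, pser (c s) (christoffel nabla s.1.1 s.1.2 s.2)) ->
  (forall i j, pser (rc i j) (fun x => r x i j)) ->
  eq_germ (ricci nabla) r <-> forall i j, ricci_coef c i j = rc i j.
Proof.
move=> cG rcr; split=> [rr i j|cE].
  apply: pser_inj (rcr i j).
  apply: pser_ext (pser_ricci i j cG); by apply: filterS rr => x ->.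
have H : \forall x \near (0 : 'rV[R]_n), forall i j, ricci nabla x i j = r x i j.
  apply: (filter_forall (F := nbhs (0 : 'rV[R]_n)) (f := fun i x =>
    forall j, ricci nabla x i j = r x i j)) => i.
  apply: (filter_forall (F := nbhs (0 : 'rV[R]_n)) (f := fun j x =>
    ricci nabla x i j = r x i j)) => j.
  apply: (pser_germ (pser_ricci i j cG)); rewrite cE; exact: rcr.
by apply: filterS H => x H; apply/matrixP => i j.
Qed.

End Connections.

(** * The Ricci equation as a Cauchy-Kovalevskaya system *)

Section CauchyKovalevskaya.
Variables (R : realType) (n : nat) (m k0 : 'I_n).
Hypothesis k0m : k0 != m.
Local Notation midx := {ffun 'I_n -> nat}.
Local Notation sym := ('I_n * 'I_n * 'I_n)%type.

Implicit Types (s t : sym) (a b : midx).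

(* The symbol whose derivative in [x^m] is given by the equation of index
   [p = (i, j)]: it is Gamma^m_{ij} if [i != m] and Gamma^{k0}_{k0 j} if
   [i = m]. *)
Definition pvar (p : 'I_n * 'I_n) : sym :=
  if p.1 == m then (k0, k0, p.2) else (m, p.1, p.2).

Definition principal (s : sym) : bool :=
  if s.1.1 == m then s.1.2 != m else (s.1.1 == k0) && (s.1.2 == k0).

Definition pindex (s : sym) : 'I_n * 'I_n :=
  if s.1.1 == m then (s.1.2, s.2) else (m, s.2).

Lemma pvarK : cancel pvar pindex.
Proof.
move=> [i j]; rewrite /pvar /pindex /=.
by have [->|_] := eqVneq i m => /=; rewrite ?(negbTE k0m) ?eqxx.
Qed.

Lemma pindexK s : principal s -> pvar (pindex s) = s.
Proof.
move: s => [[k i] j]; rewrite /principal /pindex /pvar /=.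
have [->|km] := eqVneq k m => /=; first by move=> /negbTE ->.
by move=> /andP[/eqP -> /eqP ->]; rewrite eqxx.
Qed.

Lemma principal_pvar p : principal (pvar p).
Proof.
rewrite /principal /pvar; have [//=|] := eqVneq p.1 m => /=.
  by rewrite (negbTE k0m) eqxx.
by rewrite eqxx.
Qed.

(** The sign with which the x^m-derivative of [pvar (i, j)] enters Ric: it comes from the divergence
    term if [i != m], and from the subtracted trace term if [i = m]. *)
Definition psign (i : 'I_n) : R := if i == m then -1 else 1.

Lemma psign_sqr i : psign i * psign i = 1.
Proof. by rewrite /psign; case: ifP => _; ring. Qed.

(* [ricci_coef c i j b] involves principal coefficients of order greater than
   [b m] in the variable [x^m] only through [pvar (i, j)]. *)
Lemma ricci_coef_principal (c c' : sym -> midx -> R) (i j : 'I_n) (b : midx) :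
  (forall s a, (principal s -> (a m <= b m)%N) -> c s a = c' s a) ->
  ricci_coef c i j b - ricci_coef c' i j b =
  psign i * ((b m).+1%:R * (c (pvar (i, j)) (b + munit m) - c' (pvar (i, j)) (b + munit m))).
Proof.
move=> cc'.
have conv s t : mconv (c s) (c t) b = mconv (c' s) (c' t) b.
  rewrite /mconv big_seq [RHS]big_seq; apply: eq_bigr => p.
  by rewrite mem_msplit => /eqP pb; congr (_ * _); apply: cc' => _;
    rewrite -pb mDE ?leq_addr ?leq_addl.
have dcE k s : ~~ (principal s && (k == m)) -> dcoef k (c s) b = dcoef k (c' s) b.
  move=> sk; rewrite /dcoef; congr (_ * _); apply: cc' => ps.
  by move: sk; rewrite ps mSE eq_sym /= => /negbTE ->; rewrite addn0.
rewrite /ricci_coef.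
rewrite [X in _ + X - _](_ : _ = \sum_(k < n) \sum_(l < n)
   (mconv (c' (l, i, j)) (c' (k, k, l)) b - mconv (c' (l, k, j)) (c' (k, i, l)) b)); last first.
  by apply: eq_bigr => k _; apply: eq_bigr => l _; rewrite !conv.
rewrite opprD addrACA subrr addr0 -sumrB /psign /pvar /=.
case: eqP => [->|/eqP im].
  (* No Gamma^k_{mj} is principal, and Gamma^k_{kj} is principal only for k = k0. *)
  rewrite (bigD1 k0)//= big1 ?addr0.
    rewrite (dcE k0); last by rewrite (negbTE k0m) andbF.
    by rewrite /dcoef; ring.
  move=> k kk0; rewrite (dcE k); last first.
    by rewrite /principal /= eqxx; case: (k == m); rewrite ?andbF.
  rewrite (dcE m) ?subrr// /principal /=.
  by rewrite eqxx andbT (negbTE kk0); case: (k == m).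
(* Here the trace terms are differentiated in x^i with [i != m], and only k = m gives an
   x^m-derivative in the divergence. *)
rewrite (bigD1 m)//= big1 ?addr0.
  rewrite (dcE i); last by rewrite (negbTE im) andbF.
  by rewrite /dcoef; ring.
move=> k km; rewrite (dcE k); last by rewrite (negbTE km) andbF.
by rewrite (dcE i) ?subrr// (negbTE im) andbF.
Qed.

Lemma ricci_coef_unique (c c' : sym -> midx -> R) :
  (forall i j, ricci_coef c i j = ricci_coef c' i j) ->
  (forall s a, (principal s -> a m = 0%N) -> c s a = c' s a) ->
  forall s a, c s a = c' s a.
Proof.
move=> EE h0.
have H N : forall s a, (principal s -> (a m <= N)%N) -> c s a = c' s a.
  elim: N => [|N IH] s a sa.
    by apply: h0 => /sa; rewrite leqn0 => /eqP.
  have [ps|/negbTE ps] := boolP (principal s); last by apply: h0; rewrite ps.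
  have := sa ps; rewrite leq_eqVlt => /orP[/eqP am|]; last first.
    by rewrite ltnS => amN; exact: IH.
  have a0 : (0 < a m)%N by rewrite am.
  have bm : mpred m a m = N by rewrite ffunE eqxx am subn1.
  have := @ricci_coef_principal c c' (pindex s).1 (pindex s).2 (mpred m a).
  rewrite bm => /(_ IH); rewrite EE subrr -surjective_pairing pindexK// mpredK//.
  move=> /esym/eqP; rewrite mulf_eq0 /psign; case: ifP => _; rewrite ?oppr_eq0 oner_eq0 /=;
    by rewrite mulf_eq0 pnatr_eq0 /= subr_eq0 => /eqP.
by move=> s a; exact: (H (a m)).
Qed.

Variables (g : sym -> midx -> R) (rho : 'I_n -> 'I_n -> midx -> R).

(* [ck_iter N] vanishes on the principal coefficients of order greater than
   [N] in [x^m], so that the equation for the next order only sees known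
   coefficients. *)
Fixpoint ck_iter (N : nat) : sym -> midx -> R :=
  if N is N'.+1 then fun s a =>
    if principal s && (a m == N) then
      psign (pindex s).1 / N%:R *
      (rho (pindex s).1 (pindex s).2 (mpred m a) -
       ricci_coef (ck_iter N') (pindex s).1 (pindex s).2 (mpred m a))
    else ck_iter N' s a
  else fun s a => if principal s && (a m != 0%N) then 0 else g s a.

(** The limit of the iterates: a coefficient of order [a m] no longer changes after step [a m]. *)
Definition ck_sol (s : sym) (a : midx) : R := ck_iter (a m) s a.

Lemma ck_iter_high N s a : principal s -> (N < a m)%N -> ck_iter N s a = 0.
Proof.
move=> ps; elim: N => [|N IH] Na /=.
  by rewrite ps -lt0n Na.
by rewrite ps gtn_eqF//= IH// ltnW.
Qed.

Lemma ck_iter_free N s a : ~~ principal s -> ck_iter N s a = g s a.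
Proof. by move=> /negbTE ps; elim: N => [|N IH] /=; rewrite ps. Qed.

Lemma ck_iter_stable N s a : (principal s -> (a m <= N)%N) -> ck_iter N s a = ck_sol s a.
Proof.
have [ps /(_ isT)|ps _] := boolP (principal s); last by rewrite /ck_sol !ck_iter_free.
elim: N => [|N IH]; first by rewrite leqn0 /ck_sol => /eqP ->.
rewrite leq_eqVlt => /orP[/eqP <-//|]; rewrite ltnS => aN.
by rewrite /= ltn_eqF ?ltnS//= andbF IH.
Qed.

Lemma ck_sol_init s a : (principal s -> a m = 0%N) -> ck_sol s a = g s a.
Proof.
have [ps /(_ isT) am|ps _] := boolP (principal s); last by rewrite /ck_sol ck_iter_free.
by rewrite /ck_sol am /= am eqxx andbF.
Qed.

(** At index [b] the solution is compared with the iterate [b m]: they agree on all coefficients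
    that [ricci_coef_principal] requires, the iterate vanishes at the next order, and the solution
    there was defined to make up the defect. *)
Lemma ck_sol_ricci i j : ricci_coef ck_sol i j = rho i j.
Proof.
apply/funext => b.
have := @ricci_coef_principal ck_sol (ck_iter (b m)) i j b.
move=> /(_ _)/wrap[s a sa|]; first by rewrite ck_iter_stable.
have pp := principal_pvar (i, j).
have bm : (b + munit m) m = (b m).+1 by rewrite mSE eqxx addn1.
rewrite (ck_iter_high pp) ?bm// subr0.
have -> : ck_sol (pvar (i, j)) (b + munit m) =
    psign i / (b m).+1%:R * (rho i j b - ricci_coef (ck_iter (b m)) i j b).
  by rewrite /ck_sol bm /= pp bm eqxx /= pvarK mSK.
set E := ricci_coef (ck_iter _) i j b => H; apply: (addIr (- E)); rewrite H.
rewrite -[RHS]mul1r -(psign_sqr i); field.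
by rewrite addrC natr1 pnatr_eq0 /= /psign; case: ifP => _; rewrite ?oppr_eq0 oner_eq0.
Qed.

Variable K : R.
Hypothesis K1 : 1 <= K.
Hypothesis gK : forall s a, `|g s a| <= K * K ^+ mdeg a.
Hypothesis rhoK : forall i j a, `|rho i j a| <= K * K ^+ mdeg a.

(* One term comes from [rho], [2 n] from the linear part of [ricci_coef] and
   [2 n ^ 2] from its quadratic part. *)
Definition ck_theta : R := 1 + 2 * n%:R + 2 * n%:R ^+ 2.

Lemma ck_theta_ge1 : 1 <= ck_theta.
Proof. by rewrite /ck_theta -addrA lerDl addr_ge0// mulr_ge0// exprn_ge0. Qed.

(* By [mweightS], moving a derivative from [x^k] to [x^m] does not change the
   weight, and the gain [ck_theta] per order in [x^m] then absorbs the number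
   of terms of the equation; by [mweight_conv], the quadratic terms grow no
   faster than the derivatives. *)
Definition ck_bound (s : sym) (a : midx) : R :=
  K * K ^+ mdeg a * mweight R a * ck_theta ^+ (if principal s then a m else 0).

Lemma ck_iter_bound N s a : `|ck_iter N s a| <= ck_bound s a.
Proof.
have K0 : 0 < K := lt_le_trans ltr01 K1.
have T1 := ck_theta_ge1; have T0 : 0 < ck_theta by lra.
have KX0 d : 0 <= K ^+ d by rewrite exprn_ge0// ltW.
have TX0 d : 0 <= ck_theta ^+ d by rewrite exprn_ge0// ltW.
have TX1 d : 1 <= ck_theta ^+ d by rewrite exprn_ege1.
have bound0 t b : 0 <= ck_bound t b.
  by rewrite /ck_bound !mulr_ge0// ?mweight_ge0// ltW.
elim: N s a => [|N IH] s a /=.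
  case: ifP => _; first by rewrite normr0.
  apply: (le_trans (gK s a)); rewrite /ck_bound -mulrA ler_peMr//.
    by rewrite mulr_ge0// ltW.
  by rewrite mulr_ege1// mweight_ge1.
case: ifP => // /andP[ps /eqP am].
have a0 : (0 < a m)%N by rewrite am.
set b := mpred m a; have ab : a = b + munit m by rewrite mpredK.
have bm : b m = N by rewrite ffunE eqxx am subn1.
set c := ck_iter N in IH *.
(* A common bound for every single term of the equation at [b]; [ck_theta] then counts the terms. *)
pose B := K * K ^+ (mdeg b).+1 * ((mdeg b).+1%:R * mweight R b) * ck_theta ^+ N.
have B0 : 0 <= B by rewrite /B !mulr_ge0// ?mweight_ge0// ltW.
have cB t d : `|c t d| <= K * K ^+ mdeg d * mweight R d * ck_theta ^+ d m.
  apply: (le_trans (IH t d)); rewrite /ck_bound ler_wpM2l//.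
    by rewrite !mulr_ge0// ?mweight_ge0// ltW.
  by case: ifP => // _; rewrite expr0.
have linB k t : `|dcoef k (c t) b| <= B.
  rewrite /dcoef normrM normr_nat.
  have [/andP[pt /eqP ->]|tk] := boolP (principal t && (k == m)).
    (* The only derivative that could produce the power N + 1 of [ck_theta] vanishes for this
       iterate. *)
    by rewrite /c ck_iter_high ?normr0 ?mulr0// mSE eqxx addn1 bm.
  apply: (le_trans (ler_wpM2l _ (IH _ _))) => //.
  rewrite /ck_bound mdegS /B -(@mweightS n R b k).
  rewrite [X in X <= _](_ : _ = K * K ^+ (mdeg b).+1 * ((b k).+1%:R * mweight R (b + munit k)) *
    ck_theta ^+ (if principal t then (b + munit k)%R m else 0%N)); last by ring.
  rewrite ler_wpM2l//; first by rewrite !mulr_ge0// ?mweight_ge0// ltW.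
  have [pt|_] := boolP (principal t); last by rewrite expr0.
  by move: tk; rewrite pt mSE eq_sym bm /= => /negbTE ->; rewrite addn0.
have convB s1 s2 : `|mconv (c s1) (c s2) b| <= B.
  rewrite /mconv; apply: (le_trans (ler_norm_sum _ _ _)).
  apply: (@le_trans _ _ (\sum_(p <- msplit b) (K * K * K ^+ mdeg b * ck_theta ^+ N) *
     (mweight R p.1 * mweight R p.2))).
    rewrite big_seq [leRHS]big_seq; apply: ler_sum => p; rewrite mem_msplit => /eqP pb.
    rewrite normrM; apply: (le_trans (ler_pM _ _ (cB _ _) (cB _ _))) => //.
    by rewrite -bm -pb mdegD mDE !exprD; apply: eq_ler; ring.
  (* The two prefactors [K] of a product make up for the degree that a derivative would have raised,
     so both kinds of terms fit under [B]. *)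
  rewrite -mulr_sumr mweight_conv /B exprS.
  by apply: eq_ler; ring.
have rhoB i j : `|rho i j b| <= B.
  apply: (le_trans (rhoK _ _ _)).
  rewrite (_ : B = K * K ^+ mdeg b * (K * ((mdeg b).+1%:R * mweight R b) * ck_theta ^+ N)).
    apply: ler_peMr; first by rewrite mulr_ge0// ltW.
    by rewrite !mulr_ege1 ?mweight_ge1 ?ler1n.
  by rewrite /B exprS; ring.
have EB i j : `|rho i j b - ricci_coef c i j b| <= ck_theta * B.
  apply: (le_trans (ler_normB _ _)).
  rewrite /ck_theta -addrA mulrDl mul1r lerD//.
  apply: (le_trans (ler_normD _ _)); rewrite mulrDl lerD//.
    apply: (le_trans (ler_norm_sum _ _ _)).
    apply: (@le_trans _ _ (\sum_(k < n) (2 * B))).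
      apply: ler_sum => k _; apply: (le_trans (ler_normB _ _)).
      by rewrite mulrDl mul1r lerD.
    by rewrite sumr_const card_ord -mulr_natr; apply: eq_ler; ring.
  apply: (le_trans (ler_norm_sum _ _ _)).
  apply: (@le_trans _ _ (\sum_(k < n) \sum_(l < n) (2 * B))).
    apply: ler_sum => k _; apply: (le_trans (ler_norm_sum _ _ _)).
    apply: ler_sum => l _; apply: (le_trans (ler_normB _ _)).
    by rewrite mulrDl mul1r lerD.
  rewrite !sumr_const !card_ord -mulr_natr -mulr_natr.
  by apply: eq_ler; ring.
have N0 : 0 < N.+1%:R :> R by rewrite ltr0n.
have -> : `|psign (pindex s).1 / N.+1%:R * (rho (pindex s).1 (pindex s).2 b -
    ricci_coef c (pindex s).1 (pindex s).2 b)| = N.+1%:R^-1 *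
    `|rho (pindex s).1 (pindex s).2 b - ricci_coef c (pindex s).1 (pindex s).2 b|.
  have Nn : `|N.+1%:R^-1| = N.+1%:R^-1 :> R by rewrite gtr0_norm// invr_gt0.
  rewrite !normrM Nn (_ : `|psign _| = 1) ?mul1r//.
  by rewrite /psign; case: ifP => _; rewrite ?normrN normr1.
rewrite ler_pdivrMl//; apply: (le_trans (EB _ _)).
(* By [mweightS] in direction [m], dividing by N + 1 turns the weight in [B] exactly into that of
   [a], and the number of terms becomes the additional factor [ck_theta]. *)
rewrite /ck_bound ps am {1}ab mdegS /B -(@mweightS n R b m) -ab bm exprS.
by rewrite exprS; apply: eq_ler; ring.
Qed.

Lemma ck_sol_geo s : geo_bounded (ck_sol s).
Proof.
have K0 : 0 < K := lt_le_trans ltr01 K1; have T1 := ck_theta_ge1.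
have KT0 : 0 <= K * n%:R * ck_theta by rewrite !mulr_ge0//; lra.
apply: (geo_boundedI (M := K) KT0) => a.
apply: (le_trans (ck_iter_bound _ _ _)); rewrite /ck_bound !exprMn -!mulrA.
rewrite ler_wpM2l//; first by lra.
rewrite ler_wpM2l//; first by rewrite exprn_ge0//; lra.
apply: ler_pM; rewrite ?mweight_ge0 ?mweight_le//.
  by rewrite exprn_ge0//; lra.
by apply: ler_weXn2l => //; case: ifP => // _; exact: leq_mdeg.
Qed.

End CauchyKovalevskaya.
(** * The bijection *)

Section Main.
Variables (R : realType) (n : nat).
Local Notation sym := ('I_n * 'I_n * 'I_n)%type.

Definition mrestr (m : 'I_n) (a : {ffun 'I_n -> nat}) : {ffun 'I_n.-1 -> nat} :=
  [ffun j => a (lift m j)].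

Lemma mrestrK (m : 'I_n) (a : {ffun 'I_n -> nat}) : a m = 0%N -> mins m (mrestr m a) = a.
Proof.
move=> am; apply/ffunP => i; rewrite ffunE; case: unliftP => [j ->|->//].
by rewrite ffunE.
Qed.

Lemma minsK (m : 'I_n) (b : {ffun 'I_n.-1 -> nat}) : mrestr m (mins m b) = b.
Proof. by apply/ffunP => j; rewrite !ffunE liftK. Qed.

Lemma mins0 (m : 'I_n) (b : {ffun 'I_n.-1 -> nat}) : mins m b m = 0%N.
Proof. by rewrite ffunE unlift_none. Qed.

Lemma mdeg_restr (m : 'I_n) (a : {ffun 'I_n -> nat}) : (mdeg (mrestr m a) <= mdeg a)%N.
Proof.
rewrite /mdeg [leqRHS](bigD1_ord m) //=.
by under eq_bigr do rewrite ffunE; rewrite leq_addl.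
Qed.

(** Valid for every larger constant, so that the data and the tensor, indexed by different types,
    can be put under the maximum of their constants. *)
Lemma geo_bounded_unif (T : finType) (c : T -> {ffun 'I_n -> nat} -> R) :
  (forall t, geo_bounded (c t)) ->
  exists2 K, 1 <= K & forall K', K <= K' -> forall t a, `|c t a| <= K' * K' ^+ mdeg a.
Proof.
move=> cgeo; have /choice[k ck] : forall t, exists K, 1 <= K /\
    forall a, `|c t a| <= K ^+ (mdeg a).+1.
  by move=> t; have [K K1 cK] := cgeo t; exists K.
have k0 t : 0 <= k t by have [] := ck t; lra.
exists (1 + \sum_t k t) => [|K' KK' t a]; first by rewrite lerDl sumr_ge0.
have [k1 ckt] := ck t; rewrite (le_trans (ckt a))// -exprS lerXn2r ?nnegrE//.
  by rewrite (le_trans _ KK')// addr_ge0// sumr_ge0.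
apply: le_trans KK'; rewrite (bigD1 t)//= addrCA lerDl addr_ge0// sumr_ge0//.
Qed.

Lemma card_principal (m k0 : 'I_n) : k0 != m ->
  #|[set s | principal m k0 s]%SET| = (n ^ 2)%N.
Proof.
move=> k0m; rewrite (_ : [set s | _]%SET = [set pvar m k0 p | p in [set: 'I_n * 'I_n]]%SET).
  by rewrite (card_imset _ (can_inj (pvarK k0m))) cardsT card_prod !card_ord mulnn.
apply/setP => s; rewrite inE; apply/idP/imsetP => [ps|[p _ ->]].
  by exists (pindex m s); rewrite ?inE// pindexK.
exact: principal_pvar.
Qed.

Lemma principal_enum (m k0 : 'I_n) : k0 != m ->
  exists (free : 'I_(n ^ 3 - n ^ 2)%N -> sym) (init : 'I_(n ^ 2)%N -> sym),
  [/\ bijective (fun u : 'I_(n ^ 3 - n ^ 2)%N + 'I_(n ^ 2)%N =>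
        match u with inl a => free a | inr b => init b end),
      forall a, ~~ principal m k0 (free a) & forall b, principal m k0 (init b)].
Proof.
move=> k0m; set P := [set s | principal m k0 s]%SET.
have cP : #|P| = (n ^ 2)%N := card_principal k0m.
have cT : #|{: sym}| = (n ^ 3)%N by rewrite !card_prod !card_ord !expnS expn0 muln1 mulnA.
have cC : #|~: P| = (n ^ 3 - n ^ 2)%N by rewrite cardsCs finset.setCK cP cT.
pose free a := enum_val (cast_ord (esym cC) a).
pose init b := enum_val (cast_ord (esym cP) b).
have hf a : ~~ principal m k0 (free a).
  by have := enum_valP (cast_ord (esym cC) a); rewrite !inE.
have hi b : principal m k0 (init b).
  by have := enum_valP (cast_ord (esym cP) b); rewrite inE.
exists free, init; split=> //; apply: inj_card_bij.
  move=> [a|b] [a'|b'] E.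
  - by congr inl; exact: (cast_ord_inj (enum_val_inj E)).
  - by have := hf a; rewrite E hi.
  - by have := hf a'; rewrite -E hi.
  - by congr inr; exact: (cast_ord_inj (enum_val_inj E)).
(* The subtraction in n^3 - n^2 is truncated; n^2 <= n^3 holds because the principal symbols are
   among all symbols. *)
rewrite card_sum !card_ord cT subnK//.
by rewrite -cT -cP; exact: max_card.
Qed.

Variables (m k0 : 'I_n).
Hypothesis k0m : k0 != m.
Variables (p q : nat) (free : 'I_p -> sym) (init : 'I_q -> sym).
Hypothesis fi_bij : bijective (fun u : 'I_p + 'I_q =>
  match u with inl a => free a | inr b => init b end).
Hypothesis free_np : forall a, ~~ principal m k0 (free a).
Hypothesis init_p : forall b, principal m k0 (init b).
Variable r : tensor02 R n.
Hypothesis hr : analytic_tensor02 r.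

Definition symbols_of (nabla : connop R n) : data R n p q :=
  let G (s : sym) := christoffel nabla s.1.1 s.1.2 s.2 in
  (fun a => G (free a), fun b => G (init b) \o hyperplane m).

Lemma tensor_series : exists rc, forall i j, pser (rc i j) (fun x => r x i j).
Proof.
have /choice[rc rcr] : forall ij : 'I_n * 'I_n, exists c, pser c (fun x => r x ij.1 ij.2).
  by move=> [i j]; exact: hr.
by exists (fun i j => rc (i, j)) => i j; exact: (rcr (i, j)).
Qed.

Lemma connection_series nabla : is_connection nabla ->
  exists c : sym -> {ffun 'I_n -> nat} -> R, forall s, pser (c s) (christoffel nabla s.1.1 s.1.2 s.2).
Proof.
move=> cn; have /choice[c cG] : forall s : sym, exists c,
    pser c (christoffel nabla s.1.1 s.1.2 s.2).
  by move=> s; exact: christoffel_analytic.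
by exists c.
Qed.

Lemma symbols_of_analytic nabla : ricci_family r nabla -> analytic_data (symbols_of nabla).
Proof.
move=> [cn _]; split=> [a|b] /=; first exact: christoffel_analytic.
have [c cG] := connection_series cn.
by exists (c (init b) \o mins m); apply: pser_hyperplane; exact: cG.
Qed.

Lemma symbols_of_inj nabla nabla' : ricci_family r nabla -> ricci_family r nabla' ->
  eq_data (symbols_of nabla) (symbols_of nabla') -> eq_connection nabla nabla'.
Proof.
move=> [cn rn] [cn' rn'] [/= ef ei].
have [rc rcr] := tensor_series.
have [c cG] := connection_series cn; have [c' cG'] := connection_series cn'.
have /ricci_eq_germP := rn => /(_ _ _ cG rcr) E.
have /ricci_eq_germP := rn' => /(_ _ _ cG' rcr) E'.
have cc' : forall s a, c s a = c' s a.
  apply: (ricci_coef_unique k0m) => [i j|s a]; first by rewrite E E'.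
  have [h _ hK] := fi_bij; have := hK s; case: (h s) => [u|u] <- am.
    by rewrite (pser_inj (pser_ext (ef u) (cG _)) (cG' _)).
  rewrite -(mrestrK (am (init_p u))).
  have := pser_inj (pser_ext (ei u) (pser_hyperplane m (cG _))) (pser_hyperplane m (cG' _)).
  by move=> /(congr1 (fun f => f (mrestr m a))).
apply: connection_ext => // k i j; apply: pser_germ (cG (k, i, j)) _.
by rewrite (_ : c _ = c' (k, i, j)); [exact: (cG' (k, i, j))|apply/funext => a].
Qed.

Lemma symbols_of_surj d : analytic_data d ->
  exists2 nabla, ricci_family r nabla & eq_data (symbols_of nabla) d.
Proof.
move=> [/choice[cf cfd] /choice[ci cid]].
have [rc rcr] := tensor_series.
have [h _ hK] := fi_bij.
(* For a principal symbol [ck_iter] reads [g] only where [a m = 0]; ignoring the exponent at [m]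
   elsewhere keeps the geometric bound on all indices. *)
pose g (s : sym) (a : {ffun 'I_n -> nat}) : R :=
  match h s with inl u => cf u a | inr u => ci u (mrestr m a) end.
have ggeo s : geo_bounded (g s).
  rewrite /g; case: (h s) => u; first exact: pser_geo (cfd u).
  have [K K1 cK] := pser_geo (cid u); exists K => // a.
  by rewrite (le_trans (cK _))// ler_weXn2l// ltnS mdeg_restr.
have [K K1 gK] := geo_bounded_unif ggeo.
have [K' K1' rK] : exists2 K, 1 <= K & forall K', K <= K' ->
    forall (t : 'I_n * 'I_n) a, `|rc t.1 t.2 a| <= K' * K' ^+ mdeg a.
  by apply: geo_bounded_unif => t; exact: pser_geo (rcr t.1 t.2).
pose L := Num.max K K'.
have L1 : 1 <= L by rewrite le_max K1.
have gL : forall s a, `|g s a| <= L * L ^+ mdeg a by apply: gK; rewrite le_max lexx.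
have rL i j a : `|rc i j a| <= L * L ^+ mdeg a.
  by apply: (rK L _ (i, j)); rewrite le_max lexx orbT.
have /choice[G cG] : forall s, exists f, pser (ck_sol m k0 g rc s) f.
  by move=> s; apply: pser_exists; exact: (ck_sol_geo m k0 L1 gL rL).
have GE s : christoffel (conn_of G) s.1.1 s.1.2 s.2 = G s.
  by rewrite christoffel_conn_of; case: s => -[].
have cG' s : pser (ck_sol m k0 g rc s) (christoffel (conn_of G) s.1.1 s.1.2 s.2).
  by rewrite GE.
have cn : is_connection (conn_of G).
  by apply: conn_of_connection => s; exists (ck_sol m k0 g rc s); exact: cG.
exists (conn_of G).
  split=> //; apply/(ricci_eq_germP cG' rcr) => i j; exact: ck_sol_ricci.
have hf u : h (free u) = inl u.
  by apply: (bij_inj fi_bij); rewrite hK.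
have hi u : h (init u) = inr u.
  by apply: (bij_inj fi_bij); rewrite hK.
split=> u /=.
  apply: pser_germ (cG' (free u)) _.
  have -> : ck_sol m k0 g rc (free u) = cf u; last exact: cfd.
  by apply/funext => a; rewrite ck_sol_init ?(negbTE (free_np u))// /g hf.
apply: pser_germ (pser_hyperplane m (cG' (init u))) _.
have -> : ck_sol m k0 g rc (init u) \o mins m = ci u; last exact: cid.
by apply/funext => b /=; rewrite ck_sol_init ?mins0// /g hi minsK.
Qed.

End Main.

Theorem theorem3p1 (R : realType) (n : nat) (hn : (1 < n)%N)
    (r : tensor02 R n) (hr : analytic_tensor02 r) :
  depends_bijectively (ricci_family r) (n ^ 3 - n ^ 2)%N (n ^ 2)%N.
Proof.
(* The first two coordinates, 0 and 1, serve as the two distinct indices. *)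
pose m : 'I_n := Ordinal (ltnW hn); pose k0 : 'I_n := Ordinal hn.
have k0m : k0 != m by [].
have [free [init [fi_bij free_np init_p]]] := principal_enum k0m.
exists m, free, init; split=> //; split.
- by move=> nabla; exact: symbols_of_analytic.
- move=> nabla nabla' Fn Fn'; split; last exact: (symbols_of_inj k0m fi_bij init_p hr).
  move=> nn'.
  have GG k i j : eq_germ (christoffel nabla k i j) (christoffel nabla' k i j).
    have := nn' _ _ (coord_field_analytic R i) (coord_field_analytic R j).
    by apply: filterS => x; rewrite /christoffel => ->.
  split=> u /=; first exact: GG.
  exact: (near_hyperplane m (GG _ _ _)).
- by move=> d; exact: (symbols_of_surj k0m fi_bij free_np hr).
Qed.
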